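(* For $n\ge 0$ and every $l$ with $\lfloor\frac{n+1}{2}\rfloor\le l\le\binom n2$, there is a one-to-one correspondence between $\mathscr F_n(l)$ and $\mathscr D(n,l)$; in particular $f(n,l)=d(n,l)$.
   Context: An element of a lattice is reducible if it is $y\vee z$ or $y\wedge z$ for some $y,z$ both distinct from it; an element of a poset is doubly irreducible if it has at most one upper and at most one lower cover. The nullity $\eta(P)$ of a finite poset is $|E|-|V|+c$ for its cover graph (edges = coverings), $c$ the number of components. Adjunct operation: for disjoint lattices $L_1,L_2$ and $a<b$ in $L_1$ with $b$ not covering $a$, $L_1\,]_a^b\,L_2$ is $L_1\cup L_2$ with $x\le y$ iff $x\le y$ within $L_1$ or within $L_2$, or $x\in L_1,y\in L_2,x\le a$, or $x\in L_2,y\in L_1,b\le y$. An RC-lattice is a finite lattice whose reducible elements are pairwise comparable; it is an adjunct of chains $C_0\,]_{a_1}^{b_1}C_1\cdots]_{a_r}^{b_r}C_r$ ($C_0$ maximal chain), unique up to order of adjunct pairs. A basic block is a poset that has one element, or has no doubly irreducible elements, or from which removal of a doubly irreducible element reduces nullity by one. A fundamental basic block is an RC-lattice that is a basic block whose adjunct representation has pairwise distinct adjunct pairs. $\mathscr F_n(l)$ is the set of isomorphism classes of fundamental basic blocks with exactly $n$ reducible elements and nullity $l$, and $f(n,l)=|\mathscr F_n(l)|$ (with $f(0,0)=1$). $\mathscr D(n,l)$ is the set of labeled simple graphs on the vertex set $\{1,\dots,n\}$ with exactly $l$ edges and no isolated vertices (two labeled graphs are the same iff they have the same edge set), and $d(n,l)=|\mathscr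 D(n,l)|$ (with $d(0,0)=1$). *)

(* Defs.v *)
From mathcomp Require Import all_boot all_order all_algebra.
Set Implicit Arguments. Unset Strict Implicit. Unset Printing Implicit Defensive.

Record fposet := FPoset { carrier : finType; ple : rel carrier }.

Definition plt (P : fposet) (x y : carrier P) : bool := (x != y) && @ple P x y.

Definition is_poset (P : fposet) : Prop :=
  [/\ reflexive (@ple P), antisymmetric (@ple P) & transitive (@ple P)].

Definition is_join (P : fposet) (x y z : carrier P) : bool :=
  [&& @ple P x z, @ple P y z & [forall w, (@ple P x w && @ple P y w) ==> @ple P z w]].
Definition is_meet (P : fposet) (x y z : carrier P) : bool :=
  [&& @ple P z x, @ple P z y & [forall w, (@ple P w x && @ple P w y) ==> @ple P w z]].

Definition is_lattice (P : fposet) : Prop :=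
  [/\ is_poset P, 0 < #|carrier P|,
      (forall x y : carrier P, exists z, is_join x y z) &
      (forall x y : carrier P, exists z, is_meet x y z)].

Definition reducible (P : fposet) (x : carrier P) : bool :=
  [exists y : carrier P, exists z : carrier P,
     [&& y != x, z != x & (is_join y z x || is_meet y z x)]].

Definition nred (P : fposet) : nat := #|[pred x : carrier P | reducible x]|.

Definition rc_lattice (P : fposet) : Prop :=
  is_lattice P /\
  (forall x y : carrier P, reducible x -> reducible y -> @ple P x y || @ple P y x).

Definition covers (P : fposet) (x y : carrier P) : bool :=
  plt x y && [forall z : carrier P, ~~ (plt x z && plt z y)].

Definition cover_sym (P : fposet) : rel (carrier P) :=
  fun x y => covers x y || covers y x.

(* nullity |E| - |V| + c of the cover graph *)
Definition nullity (P : fposet) : int :=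
  (#|[pred p : carrier P * carrier P | covers p.1 p.2]|%:Z
   + (n_comp (@cover_sym P) predT)%:Z - #|carrier P|%:Z)%R.

Definition dirr (P : fposet) (x : carrier P) : bool :=
  (#|[pred y | covers x y]| <= 1) && (#|[pred y | covers y x]| <= 1).

Definition remove (P : fposet) (x : carrier P) : fposet :=
  @FPoset {y : carrier P | y != x} (fun u v => @ple P (val u) (val v)).

Definition basic_block (P : fposet) : Prop :=
  [\/ #|carrier P| = 1,
      (forall x : carrier P, ~~ dirr x) |
      (forall x : carrier P, dirr x -> nullity (remove x) = (nullity P - 1)%R)].

Definition chainP (m : nat) : fposet := @FPoset 'I_m (fun i j => (i <= j)%N).

Definition adjunct (P Q : fposet) (a b : carrier P) : fposet :=
  @FPoset (carrier P + carrier Q)%type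
    (fun x y => match x, y with
                | inl x', inl y' => @ple P x' y'
                | inr x', inr y' => @ple Q x' y'
                | inl x', inr _ => @ple P x' a
                | inr _, inl y' => @ple P b y'
                end).

(* adjunct representations C0 ]_{a1}^{b1} C1 ... ]_{ar}^{br} Cr of chains *)
Inductive adj_rep : fposet -> Type :=
| RepChain (m : nat) : adj_rep (chainP m.+1)
| RepAdj (P : fposet) (rp : adj_rep P) (a b : carrier P) (k : nat) :
    adj_rep (adjunct (chainP k.+1) a b).

Fixpoint rep_pairs (P : fposet) (rp : adj_rep P) : seq (carrier P * carrier P) :=
  match rp in adj_rep Q return seq (carrier Q * carrier Q) with
  | RepChain _ => [::]
  | @RepAdj P' rp' a b k =>
      rcons [seq ((inl p.1 : carrier (adjunct (chainP k.+1) a b)), inl p.2)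
            | p <- rep_pairs rp'] (inl a, inl b)
  end.

Fixpoint rep_c0 (P : fposet) (rp : adj_rep P) : pred (carrier P) :=
  match rp in adj_rep Q return pred (carrier Q) with
  | RepChain _ => fun _ => true
  | @RepAdj P' rp' a b k =>
      fun x : carrier (adjunct (chainP k.+1) a b) =>
        match x with inl y => rep_c0 rp' y | inr _ => false end
  end.

Fixpoint rep_valid (P : fposet) (rp : adj_rep P) : Prop :=
  match rp with
  | RepChain _ => True
  | @RepAdj P' rp' a b k => [/\ rep_valid rp', is_lattice P', plt a b & ~~ covers a b]
  end.

Definition maximal_chain (P : fposet) (S : pred (carrier P)) : Prop :=
  (forall x y, S x -> S y -> @ple P x y || @ple P y x) /\
  (forall z, (forall x, S x -> @ple P x z || @ple P z x) -> S z).

Definition iso (P Q : fposet) : Prop :=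
  exists f : carrier P -> carrier Q,
    bijective f /\ forall x y, @ple Q (f x) (f y) = @ple P x y.

Definition fundamental (P : fposet) : Prop :=
  [/\ rc_lattice P, basic_block P &
      exists (Q : fposet) (rp : adj_rep Q),
        [/\ rep_valid rp, maximal_chain (rep_c0 rp), iso P Q & uniq (rep_pairs rp)]].

(* D(n,l): labeled simple graphs on n vertices (edge sets of 2-subsets),
   l edges, no isolated vertices *)
Definition Dset (n l : nat) : {set {set {set 'I_n}}} :=
  [set E : {set {set 'I_n}} | [&& [forall e in E, #|e| == 2],
                                  #|E| == l &
                                  [forall v : 'I_n, [exists e in E, v \in e]]]].

(* Main.v *)
Require Import Defs.
From mathcomp Require Import all_boot all_order all_algebra zify.
Set Implicit Arguments. Unset Strict Implicit. Unset Printing Implicit Defensive.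

(* The reducible elements of a fundamental basic block form a chain r_1 < ... < r_n, and every
   other element z is isolated: it has a single lower cover r_i and a single upper cover r_j.
   Hence x < y holds iff x <> y and x <= r_k <= y for some k, so the lattice is determined by the
   number of isolated elements between each r_i and r_j. Since removing z must lower the nullity,
   r_i and r_j have another element between them. Since adjunct pairs are distinct, the open
   interval (r_i, r_j) has at most two components. So there is exactly one such z if j > i + 1
   and exactly two if j = i + 1, and the lattice is determined by the set of pairs {i, j} that
   occur, a graph without isolated vertices. Conversely a graph gives an explicit interval order
   that is built from its maximal chain by one singleton adjunct per edge, each of which raises
   the nullity by one. *)

(** * Finite posets and their covers *)

(** An adjunct representation involves choices and lives on its own carrier, so only one consequence
    of it is extracted: an open interval has at most one more component than the multiplicity of its
    pair among the adjunct pairs. An isolated element is comparable to nothing else in its interval,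
    hence is a component by itself, and two of them leave no room for any third element. If j > i +
    1, the element r_{i+1} already occupies a component, which leaves one place for z; if j = i + 1,
    the second element demanded by the nullity can only be another isolated one. This is the origin
    of the numbers one and two. The maximal chain of the representation is not the chain of
    reducible elements: between consecutive r_i and r_{i+1} one of the two isolated elements belongs
    to it and the other is adjoined. The notion [spine] is therefore parametrised by the chain. Off
    the maximal chain there is one element per edge, which is why the nullity counts edges. *)

Definition dual (P : fposet) : fposet :=
  @FPoset (carrier P) (fun x y => @ple P y x).

(** Stated through the order and not through coverings, so that it survives the removal of an
    element other than these three, and [z] determines [a] and [b] by antisymmetry. *)
Definition isolated (P : fposet) (a b z : carrier P) : bool :=
  [&& plt a z, plt z b, [forall w, plt z w ==> ple b w]
    & [forall w, plt w z ==> ple w a]].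

Lemma plt_dual (P : fposet) (x y : carrier P) : @plt (dual P) x y = @plt P y x.
Proof. by rewrite /plt eq_sym. Qed.

Lemma covers_dual (P : fposet) (x y : carrier P) :
  @covers (dual P) x y = @covers P y x.
Proof.
rewrite /covers plt_dual; congr andb.
by apply: eq_forallb => z; rewrite !plt_dual andbC.
Qed.

Lemma is_poset_dual (P : fposet) : is_poset P -> is_poset (dual P).
Proof.
case=> r a t; split=> //=; first by move=> x y /andP[h k]; apply: a; rewrite k h.
by move=> y x z /= h k; apply: t k h.
Qed.

Lemma reducible_dual (P : fposet) (x : carrier P) :
  @reducible (dual P) x = @reducible P x.
Proof.
apply: eq_existsb => y; apply: eq_existsb => z; congr [&& _, _ & _]; exact: orbC.
Qed.

Lemma isolatedP (P : fposet) (a b z : carrier P) :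
  reflect [/\ plt a z, plt z b, forall w, plt z w -> ple b w
            & forall w, plt w z -> ple w a] (isolated a b z).
Proof.
apply: (iffP and4P) => [[h1 h2 /forallP h3 /forallP h4]|[h1 h2 h3 h4]];
  split=> //; try by move=> w hw; move: (h3 w) (h4 w); rewrite hw.
all: by apply/forallP => w; apply/implyP; auto.
Qed.

Section Poset.
Variables (P : fposet) (hP : is_poset P).
Implicit Types x y z a b c w : carrier P.

Lemma ple_refl x : ple x x.
Proof. by case: hP => r _ _; apply: r. Qed.

Lemma ple_trans y x z : ple x y -> ple y z -> ple x z.
Proof. by case: hP => _ _ t; apply: t. Qed.

Lemma ple_anti x y : ple x y -> ple y x -> x = y.
Proof. by case: hP => _ a _ h k; apply: a; rewrite h k. Qed.

Lemma pltW x y : plt x y -> ple x y.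
Proof. by case/andP. Qed.

Lemma ple_plt_trans y x z : ple x y -> plt y z -> plt x z.
Proof.
move=> xy /andP[nyz yz]; rewrite /plt (ple_trans xy yz) andbT.
by apply: contraNneq nyz => xz; rewrite (ple_anti _ yz) // -xz.
Qed.

Lemma plt_ple_trans y x z : plt x y -> ple y z -> plt x z.
Proof.
move=> /andP[nxy xy] yz; rewrite /plt (ple_trans xy yz) andbT.
by apply: contraNneq nxy => xz; rewrite (ple_anti xy) // xz.
Qed.

Lemma plt_trans y x z : plt x y -> plt y z -> plt x z.
Proof. by move=> /pltW; apply: ple_plt_trans. Qed.

Lemma plt_irr x : plt x x = false.
Proof. by rewrite /plt eqxx. Qed.

Lemma pltF x y : plt x y -> ple y x -> False.
Proof. by move=> h k; move: (plt_ple_trans h k); rewrite plt_irr. Qed.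

Lemma ple_neq_plt x y : ple x y -> x != y -> plt x y.
Proof. by move=> h k; apply/andP. Qed.

Lemma ple_eqVlt x y : ple x y -> x = y \/ plt x y.
Proof. by move=> h; case: (eqVneq x y) => [|k]; [left | right; apply/andP]. Qed.

Lemma card_below_lt x y :
  plt x y -> #|[pred w | plt w x]| < #|[pred w | plt w y]|.
Proof.
move=> xy; apply/proper_card/properP; split.
  by apply/subsetP => w; rewrite !inE => /plt_trans; apply.
by exists x; rewrite !inE ?plt_irr.
Qed.

Lemma exists_upper_cover x y : plt x y -> exists2 c, covers x c & ple c y.
Proof.
move=> xy.
have h0 : plt x y && ple y y by rewrite xy ple_refl.
case: (@arg_minnP _ y (fun c => plt x c && ple c y)
  (fun c => #|[pred w | plt w c]|) h0) => c /andP[xc cy] cmin.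
exists c => //; rewrite /covers xc; apply/forallP => z; apply/negP => /andP[xz zc].
have := cmin z; rewrite xz (ple_trans (pltW zc) cy) => /(_ isT).
by rewrite leqNgt card_below_lt.
Qed.

Lemma isolated_unique a b a' b' z :
  isolated a b z -> isolated a' b' z -> a = a' /\ b = b'.
Proof.
move=> /isolatedP[h1 h2 h3 h4] /isolatedP[k1 k2 k3 k4].
by split; apply: ple_anti; auto.
Qed.

Lemma isolated_covers_up a b z w : isolated a b z -> covers z w = (w == b).
Proof.
move=> /isolatedP[h1 h2 h3 h4]; apply/idP/eqP => [/andP[zw /forallP h]|->].
  case: (ple_eqVlt (h3 _ zw)) => // bw; move: (h b); rewrite h2 bw //.
rewrite /covers h2; apply/forallP => c; apply/negP => /andP[/h3 bc cb]; exact: pltF cb bc.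
Qed.

Lemma isolated_not_reducible a b z : isolated a b z -> ~~ reducible z.
Proof.
move=> /isolatedP[h1 h2 h3 h4].
apply/negP => /existsP[y /existsP[w /and3P[yz wz /orP[]]]] /and3P[k1 k2 /forallP k].
  by move: (k a); rewrite (h4 y) ?(h4 w) ?ple_neq_plt //= => /(pltF h1).
by move: (k b); rewrite (h3 y) ?(h3 w) ?ple_neq_plt 1?eq_sym //= => /(pltF h2).
Qed.

(** Here [a] is the meet of [z] and [c]: as [c] is not above [z], a common lower bound of the two is
    strictly below [z], hence below [a]. *)
Lemma isolated_reducible_low a b z c :
  isolated a b z -> plt a c -> plt c b -> c != z -> reducible a.
Proof.
move=> /isolatedP[h1 h2 h3 h4] ac cb cz.
have zc : ~~ ple z c.
  apply/negP => zc; apply: (pltF cb); apply: h3.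
  by apply: ple_neq_plt => //; rewrite eq_sym.
apply/existsP; exists z; apply/existsP; exists c.
case/andP: (h1) (ac) => n1 az /andP[n2 ac'].
rewrite eq_sym n1 eq_sym n2 /= /is_meet az ac' /=; apply/orP; right.
apply/forallP => w; apply/implyP => /andP[wz wc]; apply: h4.
by apply: ple_neq_plt => //; apply: contraNneq zc => <-.
Qed.

End Poset.

Lemma isolated_dual (P : fposet) (a b z : carrier P) :
  @isolated (dual P) a b z = @isolated P b a z.
Proof.
rewrite /isolated !plt_dual andbCA; congr [&& _, _ & _]; rewrite andbC.
by congr andb; apply: eq_forallb => w; rewrite plt_dual.
Qed.

Section PosetDual.
Variables (P : fposet) (hP : is_poset P).
Implicit Types x y z a b c w : carrier P.

Lemma exists_lower_cover x y : plt x y -> exists2 c, covers c y & ple x c.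
Proof.
move=> xy; have [|c] := @exists_upper_cover _ (is_poset_dual hP) y x.
  by rewrite plt_dual.
by rewrite covers_dual => h k; exists c.
Qed.

Lemma isolated_covers_down a b z w : isolated a b z -> covers w z = (w == a).
Proof.
move=> h; have := @isolated_covers_up _ (is_poset_dual hP) b a z w.
by rewrite isolated_dual covers_dual; apply.
Qed.

Lemma isolated_reducible_high a b z c :
  isolated a b z -> plt a c -> plt c b -> c != z -> reducible b.
Proof.
move=> h k l; have := @isolated_reducible_low _ (is_poset_dual hP) b a z c.
by rewrite isolated_dual reducible_dual !plt_dual; apply.
Qed.

Lemma connect_bottom b x :
  (forall y, ple b y) -> connect (@cover_sym P) b x.
Proof.
move=> hb; have [k] := ubnP #|[pred w | plt w x]|; elim: k x => // k IHk x lek.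
case: (ple_eqVlt (hb x)) => [->|bx]; first exact: connect0.
have [c cx _] := exists_lower_cover bx.
apply: (connect_trans (IHk c _)); last first.
  by apply: connect1; rewrite /cover_sym cx.
apply: (@leq_trans #|[pred w | plt w x]|); last by rewrite -ltnS.
by apply: card_below_lt; case/andP: cx.
Qed.

Lemma cover_sym_connect_sym : connect_sym (@cover_sym P).
Proof. by apply: sym_connect_sym => x y; rewrite /cover_sym orbC. Qed.

Lemma n_comp_gt0 x : 0 < n_comp (@cover_sym P) predT.
Proof.
apply/card_gt0P; exists (fingraph.root (@cover_sym P) x).
by rewrite !inE; have := roots_root cover_sym_connect_sym x; rewrite /roots => ->.
Qed.

Lemma n_comp_bottom b : (forall y, ple b y) -> n_comp (@cover_sym P) predT = 1.
Proof.
move=> hb; rewrite -(n_comp_connect cover_sym_connect_sym b).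
by apply: eq_n_comp_r => x; rewrite inE [RHS]connect_bottom.
Qed.

End PosetDual.

(** An element with the fewest elements below it works: its meet with any [y] cannot be strictly
    smaller. *)
Lemma lattice_bottom (P : fposet) :
  is_lattice P -> exists b : carrier P, forall y, ple b y.
Proof.
case=> hP /card_gt0P[x0 _] _ hmeet.
case: (@arg_minnP _ x0 predT (fun c => #|[pred w | plt w c]|) isT) => b _ bmin.
exists b => y; have [m /and3P[mb my _]] := hmeet b y.
case: (ple_eqVlt mb) => [<- //|/(card_below_lt hP)].
by rewrite ltnNge bmin.
Qed.

(** Descending along lower covers joins every element to the bottom, so the cover graph is
    connected. *)
Lemma nullity_lattice (P : fposet) : is_lattice P ->
  nullity P = (#|[pred p : carrier P * carrier P | covers p.1 p.2]|%:Z
               + 1 - #|carrier P|%:Z)%R.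
Proof.
move=> hL; have [b hb] := lattice_bottom hL; case: hL => hP _ _ _.
by rewrite /nullity (n_comp_bottom hP hb).
Qed.

(** * Chains with isolated complement *)

(** Kept general in [C], because it is applied both to the chain of reducible elements and to a
    maximal chain. *)
Definition spine (P : fposet) (C : pred (carrier P)) : Prop :=
  [/\ is_poset P, forall x y, C x -> C y -> ple x y || ple y x,
      exists x, C x
    & forall z, ~~ C z -> exists a b, [/\ C a, C b & isolated a b z]].

Lemma spine_dual (P : fposet) (C : pred (carrier P)) :
  spine C -> @spine (dual P) C.
Proof.
case=> hP tot ne iso; split=> //; first exact: is_poset_dual.
  by move=> x y hx hy; rewrite orbC; apply: tot.
by move=> z /iso[a [b [ha hb h]]]; exists b, a; rewrite isolated_dual.
Qed.

Lemma spine_upper (P : fposet) (C : pred (carrier P)) (x : carrier P) :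
  spine C -> exists u, [/\ C u, ple x u & forall w, plt x w -> ple u w].
Proof.
case=> hP tot ne iso; case: (boolP (C x)) => [cx|/iso[a [b [ha hb /isolatedP[h1 h2 h3 h4]]]]].
  by exists x; split=> //; [apply: ple_refl | move=> w; apply: pltW].
by exists b; split=> //; apply: pltW.
Qed.

(** Every [x] has a spine element at or above it that lies below everything strictly above [x]. For
    incomparable elements the larger of the two such spine elements is the join. *)
Lemma spine_join (P : fposet) (C : pred (carrier P)) (x y : carrier P) :
  spine C -> exists z, is_join x y z.
Proof.
move=> hS; have [hP tot _ _] := hS.
have [xy|nxy] := boolP (ple x y).
  by exists y; rewrite /is_join xy ple_refl //; apply/forallP => w; apply/implyP => /andP[].
have [yx|nyx] := boolP (ple y x).
  by exists x; rewrite /is_join yx ple_refl //; apply/forallP => w; apply/implyP => /andP[].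
wlog le : x y nxy nyx / exists u v, [/\ ple x u, ple y v, ple u v
    & forall w, plt y w -> ple v w].
  have [u [cu xu hu]] := spine_upper x hS.
  have [v [cv yv hv]] := spine_upper y hS.
  move=> H; case/orP: (tot _ _ cu cv) => uv; first by apply: H => //; exists u, v.
  case: (H y x nyx nxy); first by exists v, u.
  move=> z /and3P[h1 h2 /forallP h3]; exists z; rewrite /is_join h1 h2 /=.
  by apply/forallP => w; rewrite andbC.
have [u [v [xu yv uv hv]]] := le.
exists v; rewrite /is_join yv (ple_trans hP xu uv) /=.
apply/forallP => w; apply/implyP => /andP[xw yw]; apply: hv.
by apply: ple_neq_plt => //; apply: contraNneq nxy => ->.
Qed.

Lemma spine_lattice (P : fposet) (C : pred (carrier P)) : spine C -> is_lattice P.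
Proof.
move=> hS; have [hP _ [x hx] _] := hS; split=> //.
- by apply/card_gt0P; exists x.
- by move=> *; apply: spine_join hS.
- by move=> y z; apply: spine_join (spine_dual hS).
Qed.

(** * Removing an isolated element *)

Section Remove.
Variables (P : fposet) (hP : is_poset P) (x : carrier P).
Local Notation T := (carrier P).
Local Notation P' := (remove x).

Lemma remove_poset : is_poset P'.
Proof.
case: hP => r a t; split; first by move=> y; apply: r.
  by move=> y z /a /val_inj.
by move=> y z w; apply: t.
Qed.

Lemma plt_remove (u v : carrier P') : plt u v = plt (val u) (val v).
Proof. by rewrite /plt -val_eqE. Qed.

Lemma card_remove : #|carrier P| = #|carrier P'|.+1.
Proof.
rewrite [in RHS]card_sub (cardD1 x) inE add1n; congr _.+1.
by apply: eq_card => y; rewrite !inE andbT.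
Qed.

Lemma covers_val (u v : carrier P') : covers (val u) (val v) -> covers u v.
Proof.
case/andP=> uv /forallP h; rewrite /covers plt_remove uv.
by apply/forallP => z; rewrite !plt_remove; apply: h.
Qed.

(** Coverings of [P] that avoid [x]. Removal may create further ones, so [remove x] can have more
    coverings than these. *)
Definition kept_covers := [pred p : carrier P' * carrier P' | covers (val p.1) (val p.2)].

Lemma card_covers_remove :
  #|[pred p : T * T | covers p.1 p.2]| =
  #|kept_covers| + #|[pred y | covers x y]| + #|[pred y | covers y x]|.
Proof.
set A := [pred p : T * T | covers p.1 p.2].
have -> : #|[pred y | covers x y]| = #|[predI [pred p : T * T | p.1 == x] & A]|.
  have inj : injective (fun y : T => (x, y)) by move=> y z [].
  have -> : #|[pred y | covers x y]| = #|[preim (fun y : T => (x, y)) of A]|.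
    by apply: eq_card => y; rewrite !inE.
  rewrite (card_preim inj); apply: eq_card => -[y z]; rewrite !inE /=.
  by congr andb; apply/codomP/eqP => [[w [->]]|->] //; exists z.
have -> : #|[pred y | covers y x]| = #|[predI [pred p : T * T | p.2 == x] & A]|.
  have inj : injective (fun y : T => (y, x)) by move=> y z [].
  have -> : #|[pred y | covers y x]| = #|[preim (fun y : T => (y, x)) of A]|.
    by apply: eq_card => y; rewrite !inE.
  rewrite (card_preim inj); apply: eq_card => -[y z]; rewrite !inE /=.
  by congr andb; apply/codomP/eqP => [[w [_ ->]]|->] //; exists y.
have -> : #|kept_covers| = #|[predI [pred p : T * T | (p.1 != x) && (p.2 != x)] & A]|.
  pose f (p : carrier P' * carrier P') : T * T := (val p.1, val p.2).
  have inj : injective f by move=> [a b] [c d] [/val_inj -> /val_inj ->].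
  have -> : #|kept_covers| = #|[preim f of A]| by apply: eq_card => p; rewrite !inE.
  rewrite (card_preim inj); apply: eq_card => -[y z]; rewrite !inE /=.
  congr andb; apply/codomP/andP => [[[u v] [-> ->]]|[hy hz]].
    by split; [apply: (valP u) | apply: (valP v)].
  by exists (Sub y hy, Sub z hz).
rewrite -(cardID [pred p : T * T | p.1 == x] A) addnAC addnC.
congr addn; last by apply: eq_card => p; rewrite !inE andbC.
rewrite -(cardID [pred p : T * T | p.2 == x] [predD A & [pred p | p.1 == x]]) addnC.
congr addn; apply: eq_card => -[y z]; rewrite !inE /=.
  by rewrite [RHS]andbAC andbC andbA andbC andbA.
rewrite andbC; case: (eqVneq z x) => //= ->; case: (eqVneq y x) => //= ->.
by rewrite /covers plt_irr.
Qed.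

Lemma kept_covers_sub :
  kept_covers \subset [pred p : carrier P' * carrier P' | covers p.1 p.2].
Proof. by apply/subsetP => p; rewrite !inE; apply: covers_val. Qed.

End Remove.

Lemma isolated_remove (P : fposet) (x : carrier P) (a b z : carrier (remove x)) :
  isolated (val a) (val b) (val z) -> isolated a b z.
Proof.
move=> /isolatedP[h1 h2 h3 h4]; apply/isolatedP.
by split; rewrite ?plt_remove // => w; rewrite plt_remove; [apply: h3 | apply: h4].
Qed.

Lemma spine_remove (P : fposet) (C : pred (carrier P)) (x : carrier P) :
  spine C -> ~~ C x -> @spine (remove x) (fun y => C (val y)).
Proof.
move=> [hP tot [c hc] hiso] nCx.
have inP' y : C y -> exists2 y' : carrier (remove x), val y' = y & C (val y').
  move=> cy; have yx : y != x by apply: contraNneq nCx => <-.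
  by exists (Sub y yx).
split; first exact: remove_poset.
- by move=> y z; apply: tot.
- by have [c' _ hc'] := inP' _ hc; exists c'.
- move=> z /hiso[a [b [/inP'[a' <- ca] /inP'[b' <- cb] h]]].
  by exists a', b'; split=> //; apply: isolated_remove.
Qed.

(** Two edges and one vertex disappear while the graph stays connected. No covering is created,
    because [c] still separates [a] from [b]. *)
Lemma nullity_remove_isolated (P : fposet) (C : pred (carrier P))
    (a b c z : carrier P) :
  spine C -> ~~ C z -> isolated a b z -> plt a c -> plt c b -> c != z ->
  nullity (remove z) = (nullity P - 1)%R.
Proof.
move=> hS nCz hz ac cb cz; have [hP _ _ _] := hS.
rewrite !nullity_lattice; [|exact: spine_lattice hS|exact: spine_lattice (spine_remove hS nCz)].
rewrite (card_remove z) (card_covers_remove z).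
have -> : #|[pred y | covers z y]| = 1.
  by rewrite -(card1 b); apply: eq_card => y; rewrite !inE (isolated_covers_up hP _ hz).
have -> : #|[pred y | covers y z]| = 1.
  by rewrite -(card1 a); apply: eq_card => y; rewrite !inE (isolated_covers_down hP _ hz).
suff -> : #|kept_covers z| =
    #|[pred p : carrier (remove z) * carrier (remove z) | covers p.1 p.2]| by lia.
apply: eq_card => -[u v]; rewrite !inE /=; apply/idP/idP; first exact: covers_val.
case/andP; rewrite plt_remove => uv /forallP h; rewrite /covers uv.
apply/forallP => w; apply/negP => /andP[uw wv].
have [wz|wz] := eqVneq w z; last first.
  by move: (h (Sub w wz)); rewrite !plt_remove uw wv.
(* With [z] between [u] and [v], [u] is below [a] and [b] is below [v]; then [c] lies between them
   as well. *)
move: uw wv; rewrite wz; case/isolatedP: hz => _ _ h3 h4 /h4 ua /h3 bv.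
move: (h (Sub c cz)); rewrite !plt_remove (ple_plt_trans hP ua ac).
by rewrite (plt_ple_trans hP cb bv).
Qed.

(** * Isomorphisms *)

Section Iso.
Variables (P Q : fposet) (f : carrier P -> carrier Q).
Hypotheses (fbij : bijective f) (fle : forall x y, ple (f x) (f y) = ple x y).

Lemma forallb_bij (p : pred (carrier Q)) : [forall w, p w] = [forall w, p (f w)].
Proof.
case: fbij => g fg gf; apply/forallP/forallP => h w; first exact: h.
by rewrite -(gf w).
Qed.

Lemma existsb_bij (p : pred (carrier Q)) : [exists w, p w] = [exists w, p (f w)].
Proof.
case: fbij => g fg gf; apply/existsP/existsP => -[w h]; last by exists (f w).
by exists (g w); rewrite gf.
Qed.

Lemma card_bij (p : pred (carrier Q)) : #|p| = #|[pred x | p (f x)]|.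
Proof.
have := card_preim (bij_inj fbij) p.
rewrite (eq_card (B := [pred x | p (f x)])) => [->|x]; last by rewrite !inE.
case: fbij => g fg gf; apply: eq_card => y; rewrite inE /=.
by rewrite -[in y \in codom f](gf y) codom_f.
Qed.

Lemma plt_iso x y : plt (f x) (f y) = plt x y.
Proof. by rewrite /plt fle (inj_eq (bij_inj fbij)). Qed.

Lemma isolated_iso a b z : isolated (f a) (f b) (f z) = isolated a b z.
Proof.
rewrite /isolated !plt_iso !forallb_bij; congr [&& _, _, _ & _].
  by apply: eq_forallb => w; rewrite plt_iso fle.
by apply: eq_forallb => w; rewrite plt_iso fle.
Qed.

Lemma covers_iso x y : covers (f x) (f y) = covers x y.
Proof.
rewrite /covers plt_iso forallb_bij; congr andb.
by apply: eq_forallb => w; rewrite !plt_iso.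
Qed.

Lemma is_join_iso x y z : is_join (f x) (f y) (f z) = is_join x y z.
Proof.
rewrite /is_join !fle forallb_bij; congr [&& _, _ & _].
by apply: eq_forallb => w; rewrite !fle.
Qed.

Lemma is_meet_iso x y z : is_meet (f x) (f y) (f z) = is_meet x y z.
Proof.
rewrite /is_meet !fle forallb_bij; congr [&& _, _ & _].
by apply: eq_forallb => w; rewrite !fle.
Qed.

Lemma reducible_iso x : reducible (f x) = reducible x.
Proof.
rewrite /reducible existsb_bij; apply: eq_existsb => y.
rewrite existsb_bij; apply: eq_existsb => z.
by rewrite !(inj_eq (bij_inj fbij)) is_join_iso is_meet_iso.
Qed.

Lemma is_lattice_iso : is_lattice P -> is_lattice Q.
Proof.
have [g fg gf] := fbij.
have gle x y : ple (g x) (g y) = ple x y by rewrite -fle !gf.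
case=> [[r a t]] /card_gt0P[x0 _] hj hm; split.
- split; first by move=> x; rewrite -gle.
    by move=> x y; rewrite -!gle => /a h; rewrite -(gf x) h gf.
  by move=> y x z; rewrite -!gle; apply: t.
- by apply/card_gt0P; exists (f x0).
- move=> x y; have [z] := hj (g x) (g y).
  by rewrite -is_join_iso !gf => h; exists (f z).
- move=> x y; have [z] := hm (g x) (g y).
  by rewrite -is_meet_iso !gf => h; exists (f z).
Qed.

End Iso.

Lemma card_covers_iso (P Q : fposet) : iso P Q ->
  #|[pred p : carrier P * carrier P | covers p.1 p.2]| =
  #|[pred p : carrier Q * carrier Q | covers p.1 p.2]|.
Proof.
case=> f [fbij fle]; pose F (p : carrier P * carrier P) := (f p.1, f p.2).
have [g fg gf] := fbij.
have Finj : injective F by move=> [a b] [c d] [/(bij_inj fbij) -> /(bij_inj fbij) ->].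
have := card_preim Finj [pred p : carrier Q * carrier Q | covers p.1 p.2].
rewrite (eq_card (B := [pred p : carrier P * carrier P | covers p.1 p.2])) => [->|p].
  apply: eq_card => -[x y]; rewrite !inE /=.
  suff -> : (x, y) \in codom F by [].
  by apply/codomP; exists (g x, g y); rewrite /F /= !gf.
by rewrite !inE /= covers_iso.
Qed.

Lemma nullity_iso (P Q : fposet) :
  is_lattice P -> iso P Q -> nullity P = nullity Q.
Proof.
move=> hL h; have [f [fbij fle]] := h.
rewrite !nullity_lattice //; last exact: is_lattice_iso fbij fle hL.
by rewrite (card_covers_iso h) (bij_eq_card fbij).
Qed.

Lemma total_iso_chain (P : fposet) : is_poset P ->
  (forall x y : carrier P, ple x y || ple y x) ->
  exists f : carrier P -> carrier (chainP #|carrier P|),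
    bijective f /\ forall x y, ple (f x) (f y) = ple x y.
Proof.
move=> hP tot.
have lt (x : carrier P) : #|[pred w | plt w x]| < #|carrier P|.
  rewrite -cardsT; apply/proper_card/properP; split; first by apply/subsetP => y; rewrite !inE.
  by exists x; rewrite !inE ?plt_irr.
pose f (x : carrier P) : carrier (chainP #|carrier P|) := Ordinal (lt x).
have fle x y : ple (f x) (f y) = ple x y.
  rewrite /f /=; apply/idP/idP => [|xy].
    case/orP: (tot x y) => // /ple_eqVlt[->|/(card_below_lt hP)]; first by rewrite ple_refl.
    by rewrite ltnNge => /negP.
  by case: (ple_eqVlt xy) => [->//|/(card_below_lt hP)/ltnW].
exists f; split=> //; apply: inj_card_bij; last by rewrite card_ord.
by move=> x y e; apply: ple_anti => //; rewrite -fle e /= leqnn.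
Qed.

Lemma card_covers_chain m :
  #|[pred p : carrier (chainP m.+1) * carrier (chainP m.+1) | covers p.1 p.2]| = m.
Proof.
have E (i j : carrier (chainP m.+1)) : covers i j = (j == i.+1 :> nat).
  rewrite /covers /plt -val_eqE /=; apply/idP/idP.
    case/andP => ij /forallP h; apply/negPn/negP => nj.
    have lt : i.+1 < m.+1 by have := ltn_ord j; lia.
    by move: (h (Ordinal lt)); rewrite -!val_eqE /=; lia.
  move=> /eqP e; apply/andP; split; first by lia.
  by apply/forallP => k; rewrite -!val_eqE /=; lia.
pose F (i : 'I_m) : carrier (chainP m.+1) * carrier (chainP m.+1) :=
  (widen_ord (leqnSn m) i, lift ord0 i).
have Finj : injective F by move=> i j [_] /val_inj.
rewrite -[RHS](card_ord m) -(card_codom Finj); apply: eq_card => -[i j].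
rewrite !inE E /=; apply/eqP/codomP => [e|[k [-> ->]]] //.
have lt : i < m by have := ltn_ord j; lia.
by exists (Ordinal lt); congr pair; apply: val_inj => //=; rewrite /bump; lia.
Qed.

(** * Adjunct representations *)

(* The complement of [C] can be adjoined to the maximal chain [C] one singleton at a time. *)
Definition adjunct_spine (P : fposet) (C : pred (carrier P)) : Prop :=
  [/\ is_poset P, forall x y, C x -> C y -> ple x y || ple y x,
      exists x, C x
    & forall z, ~~ C z -> exists a b c,
        [/\ C a, C b, C c, isolated a b z & plt a c && plt c b]].

Lemma adjunct_spineW (P : fposet) (C : pred (carrier P)) :
  adjunct_spine C -> spine C.
Proof.
by case=> hP tot ne h; split=> // z /h[a [b [c [ca cb _ hz _]]]]; exists a, b.
Qed.

Lemma adjunct_spine_remove (P : fposet) (C : pred (carrier P)) (x : carrier P) :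
  adjunct_spine C -> ~~ C x -> @adjunct_spine (remove x) (fun y => C (val y)).
Proof.
move=> hS nCx; have [hP' tot' ne' _] := spine_remove (adjunct_spineW hS) nCx.
case: hS => hP tot _ hiso; split=> // z /hiso[a [b [c [ca cb cc hz h]]]].
have inP' y : C y -> y != x by move=> cy; apply: contraNneq nCx => <-.
exists (Sub a (inP' _ ca)), (Sub b (inP' _ cb)), (Sub c (inP' _ cc)).
by split=> //; apply: isolated_remove.
Qed.

Lemma card_compl0 (T : finType) (C : pred T) :
  #|[pred x | ~~ C x]| = 0 -> forall x, C x.
Proof. by move=> /card0_eq h x; have := h x; rewrite !inE => /negbFE. Qed.

Lemma card_remove_compl (P : fposet) (C : pred (carrier P)) (z : carrier P) :
  ~~ C z -> #|[pred x | ~~ C x]| = #|[pred x : carrier (remove z) | ~~ C (val x)]|.+1.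
Proof.
move=> nCz; rewrite (cardD1 z) inE nCz add1n; congr _.+1.
rewrite [RHS](_ : _ = #|[preim (val : carrier (remove z) -> carrier P) of [pred x | ~~ C x]]|) //.
rewrite (card_preim val_inj); apply: eq_card => y; rewrite !inE; congr andb.
apply/idP/codomP => [h|[u ->]]; [by exists (Sub y h) | exact: (valP u)].
Qed.

(** Elements off the chain are removed one at a time, each costing one unit of nullity, until a
    chain of nullity 0 remains. *)
Lemma adjunct_spine_nullity (P : fposet) (C : pred (carrier P)) :
  adjunct_spine C -> nullity P = Posz #|[pred x | ~~ C x]|.
Proof.
have [k] := ubnP #|[pred x | ~~ C x]|; elim: k P C => // k IHk P C lek hS.
have hS' := adjunct_spineW hS; have [hP tot ne hz] := hS.
case: (posnP #|[pred x | ~~ C x]|) => [e0|/card_gt0P[z]].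
  rewrite e0; have allC := card_compl0 e0.
  have [|f [fbij fle]] := @total_iso_chain P hP; first by move=> x y; apply: tot.
  have hL := spine_lattice hS'; have [_ c0 _ _] := hL.
  rewrite nullity_lattice // (@card_covers_iso P (chainP #|carrier P|)); last by exists f.
  by case: #|carrier P| c0 => // m _; rewrite card_covers_chain; lia.
rewrite inE => nCz; have [a [b [c [ca cb cc hi /andP[ac cb']]]]] := hz z nCz.
have cz : c != z by apply: contraNneq nCz => <-.
have := nullity_remove_isolated hS' nCz hi ac cb' cz.
move: lek; rewrite (card_remove_compl nCz) ltnS => lek.
have := IHk (remove z) (fun y => C (val y)) lek (adjunct_spine_remove hS nCz).
lia.
Qed.

(** An element off [C] is incomparable to the chain element [c] that lies between its two ends. *)
Lemma adjunct_spine_maximal (P : fposet) (C : pred (carrier P)) :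
  adjunct_spine C -> maximal_chain C.
Proof.
case=> hP tot _ hz; split=> // z h; apply/negPn/negP => nCz.
have [a [b [c [ca cb cc /isolatedP[h1 h2 h3 h4] /andP[ac cb']]]]] := hz z nCz.
have cz : c != z by apply: contraNneq nCz => <-.
case/orP: (h c cc) => k.
  by apply: (pltF hP ac); apply: h4; apply: ple_neq_plt.
by apply: (pltF hP cb'); apply: h3; apply: ple_neq_plt; rewrite 1?eq_sym.
Qed.

Section AdjunctIso.
Variables (P Q : fposet) (hP : is_poset P) (z : carrier P).
Variables (f : carrier (remove z) -> carrier Q) (a b : carrier (remove z)).
Hypotheses (fbij : bijective f) (fle : forall x y, ple (f x) (f y) = ple x y).
Hypothesis hz : isolated (val a) (val b) z.

(** An isolated [z] is a one-element chain adjoined at its two ends; [insub] fails exactly at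
    [z]. *)
Definition extend_iso (x : carrier P) : carrier (adjunct (chainP 1) (f a) (f b)) :=
  if insub x is Some x' then inl (f x') else inr ord0.

Lemma extend_iso_val (x : carrier (remove z)) : extend_iso (val x) = inl (f x).
Proof. by rewrite /extend_iso valK. Qed.

Lemma extend_iso_z : extend_iso z = inr ord0.
Proof. by rewrite /extend_iso insubF // eqxx. Qed.

Lemma extend_iso_cases (x : carrier P) :
  x = z \/ exists x' : carrier (remove z), x = val x'.
Proof.
by case: (eqVneq x z) => [|h]; [left | right; exists (Sub x h)].
Qed.

Lemma extend_iso_bij : bijective extend_iso.
Proof.
have [g fg gf] := fbij.
exists (fun y => match y with inl q => val (g q) | inr _ => z end).
  move=> x; case: (extend_iso_cases x) => [->|[x' ->]].
    by rewrite extend_iso_z.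
  by rewrite extend_iso_val fg.
case=> [q|i]; first by rewrite extend_iso_val gf.
by rewrite extend_iso_z (ord1 i).
Qed.

Lemma extend_iso_le x y : ple (extend_iso x) (extend_iso y) = ple x y.
Proof.
case/isolatedP: hz => h1 h2 h3 h4.
case: (extend_iso_cases x) => [->|[x' ->]]; case: (extend_iso_cases y) => [->|[y' ->]].
- by rewrite extend_iso_z /= (ple_refl hP).
- rewrite extend_iso_z extend_iso_val /= fle /=; apply/idP/idP => [k|k].
    exact: (ple_trans hP (pltW h2) k).
  by apply: h3; apply: ple_neq_plt => //; rewrite eq_sym; apply: (valP y').
- rewrite extend_iso_z extend_iso_val /= fle /=; apply/idP/idP => [k|k].
    exact: (ple_trans hP k (pltW h1)).
  by apply: h4; apply: ple_neq_plt => //; apply: (valP x').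
- by rewrite !extend_iso_val /= fle.
Qed.

End AdjunctIso.

(** The elements off the chain are adjoined one by one, each at its own two ends. The last clause,
    that every recorded pair comes from such an element, carries the distinctness of the pairs
    through the induction. *)
Lemma adjunct_spine_rep (P : fposet) (C : pred (carrier P)) :
  adjunct_spine C ->
  (forall a b z z', ~~ C z -> ~~ C z' ->
     isolated a b z -> isolated a b z' -> z = z') ->
  exists (Q : fposet) (rp : adj_rep Q) (f : carrier P -> carrier Q),
    [/\ bijective f, forall x y, ple (f x) (f y) = ple x y,
        rep_valid rp, forall x, rep_c0 rp (f x) = C x
      & uniq (rep_pairs rp) /\
        forall p, p \in rep_pairs rp -> exists a b z,
          [/\ ~~ C z, isolated a b z & p = (f a, f b)]].
Proof.
have [k] := ubnP #|[pred x | ~~ C x]|; elim: k P C => // k IHk P C lek hS hd.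
have hS' := adjunct_spineW hS; have [hP tot ne hz] := hS.
case: (posnP #|[pred x | ~~ C x]|) => [e0|/card_gt0P[z]].
  have allC := card_compl0 e0.
  have [|f [fbij fle]] := @total_iso_chain P hP; first by move=> x y; apply: tot.
  have [_ c0 _ _] := spine_lattice hS'.
  case: #|carrier P| c0 f fbij fle => // m _ f fbij fle.
  exists (chainP m.+1), (RepChain m), f; split=> // x; by rewrite allC.
rewrite inE => nCz; have [a [b [c [ca cb cc hi acb]]]] := hz z nCz.
have inP' y : C y -> y != z by move=> cy; apply: contraNneq nCz => <-.
move: lek; rewrite (card_remove_compl nCz) ltnS => lek.
have hSr := adjunct_spine_remove hS nCz.
pose Cr := fun y : carrier (remove z) => C (val y).
(* The ends of [w] in [P] belong to [C], so they survive the removal of [z]; uniqueness of ends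
   identifies them with those in [remove z]. *)
have lift_iso (u v w : carrier (remove z)) :
    ~~ Cr w -> isolated u v w -> isolated (val u) (val v) (val w).
  move=> nCw hw; have [a0 [b0 [c0 [ca0 cb0 _ hw0 _]]]] := hz _ nCw.
  have hw1 := @isolated_remove P z (Sub a0 (inP' _ ca0)) (Sub b0 (inP' _ cb0)) w hw0.
  by have [-> ->] := isolated_unique (remove_poset hP z) hw hw1.
have [|Q [rp [f [fbij fle hv hc0 [hu hp]]]]] := IHk _ Cr lek hSr.
  move=> u v w w' nw nw' hw hw'; apply: val_inj.
  exact: hd nw nw' (lift_iso _ _ _ nw hw) (lift_iso _ _ _ nw' hw').
pose a' : carrier (remove z) := Sub a (inP' _ ca).
pose b' : carrier (remove z) := Sub b (inP' _ cb).
pose c' : carrier (remove z) := Sub c (inP' _ cc).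
have hi' : isolated (val a') (val b') z by [].
exists (adjunct (chainP 1) (f a') (f b')), (RepAdj rp (f a') (f b') 0), (extend_iso f a' b').
split.
- exact: extend_iso_bij.
- exact: extend_iso_le.
- split=> //.
  + exact: is_lattice_iso fbij fle (spine_lattice (spine_remove hS' nCz)).
  + rewrite (plt_iso fbij fle) plt_remove.
    by case/andP: acb => ac cb'; apply: (plt_trans hP ac cb').
  + rewrite (covers_iso fbij fle) /covers negb_and; apply/orP; right.
    by rewrite negb_forall; apply/existsP; exists c'; rewrite negbK !plt_remove.
- move=> x; case: (@extend_iso_cases P z x) => [->|[x' ->]].
    by rewrite extend_iso_z /= (negbTE nCz).
  by rewrite extend_iso_val /= hc0.
- rewrite /= rcons_uniq; split.
    rewrite map_inj_uniq ?hu ?andbT; last by move=> [u v] [u' v'] [-> ->].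
    (* A repeated pair would come from some [w] with the same ends as [z]; then [w] is [z], which
       has been removed. *)
    apply/mapP => -[[u v] huv] [eu ev].
    move: huv; rewrite -eu -ev => /hp[a0 [b0 [w [nw hw [/(bij_inj fbij) ea /(bij_inj fbij) eb]]]]].
    move: hw; rewrite -ea -eb => /(lift_iso _ _ _ nw) hw.
    have := hd _ _ _ _ nw nCz hw hi => e.
    by have := valP w; rewrite /= e eqxx.
  move=> p; rewrite mem_rcons inE => /orP[/eqP->|/mapP[[u v] /hp[a0 [b0 [w [nw hw [-> ->]]]]] ->]].
    exists a, b, z; split=> //.
    by rewrite -(@extend_iso_val P Q z f a' b' a') -(@extend_iso_val P Q z f a' b' b').
  exists (val a0), (val b0), (val w); split=> //; first exact: lift_iso.
  by rewrite !extend_iso_val.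
Qed.

(** * Components of open intervals *)

Definition between (P : fposet) (a b w : carrier P) : bool := plt a w && plt w b.

Definition between_rel (P : fposet) (a b : carrier P) : rel (carrier P) :=
  fun x y => [&& between a b x, between a b y & ple x y || ple y x].

(** A bound on the number of components, given by a list of at most [k] elements that reaches every
    component, so that no component has to be counted. *)
Definition components_le (P : fposet) (a b : carrier P) (k : nat) : Prop :=
  exists2 s : seq (carrier P), size s <= k
    & forall w, between a b w -> exists2 g, g \in s & connect (between_rel a b) w g.

Lemma total_components_le (P : fposet) (a b : carrier P) (k : nat) :
  (forall x y, between a b x -> between a b y -> ple x y || ple y x) ->
  components_le a b k.+1.
Proof.
move=> tot; case: (pickP (between a b)) => [w0 hw0|none]; last first.
  by exists [::] => // w; rewrite none.
exists [:: w0] => // w hw; exists w0; first exact: mem_head.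
by apply: connect1; rewrite /between_rel hw hw0 tot.
Qed.

Lemma hub_components_le (P : fposet) (a b g : carrier P) (k : nat) :
  between a b g -> (forall x, between a b x -> ple x g || ple g x) ->
  components_le a b k.+1.
Proof.
move=> hg h; exists [:: g] => // w hw; exists g; first exact: mem_head.
by apply: connect1; rewrite /between_rel hw hg h.
Qed.

Lemma adjunct_components_le (P : fposet) (a b : carrier P) (m : nat)
    (Q := adjunct (chainP m.+1) a b) (k : carrier P -> carrier P -> nat) :
  is_lattice P -> plt a b -> (forall x y, components_le x y (k x y)) ->
  (forall x y, @components_le Q (inl x) (inl y) (((x == a) && (y == b)) + k x y)).
Proof.
case=> hP _ _ _ ab IH x y; have [s hs hg] := IH x y.
have pl u v : @plt Q (inl u) (inl v) = plt u v by [].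
have pconn u v : connect (between_rel x y) u v ->
    connect (@between_rel Q (inl x) (inl y)) (inl u) (inl v).
  case/connectP => p; elim: p u => [u _ ->|w p IHp u /=]; first exact: connect0.
  case/andP=> uw wp lp; apply: connect_trans (IHp _ wp lp).
  exact: (@connect1 _ (@between_rel Q (inl x) (inl y))).
have [/andP[/eqP ex /eqP ey]|ne] := boolP ((x == a) && (y == b)).
  exists ((inr ord0 : carrier Q) :: map inl s); first by rewrite /= size_map add1n.
  case=> [w|w] hw.
    have [g gs cg] := hg w hw; exists (inl g); last exact: pconn.
    by rewrite inE map_f ?orbT.
  exists (inr ord0); first exact: mem_head.
  apply: connect1; rewrite /between_rel hw /between /plt /=.
  by rewrite ex ey !(ple_refl hP) leq0n orbT.
rewrite add0n; exists (map inl s : seq (carrier Q)); first by rewrite size_map.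
case=> [w|w] hw.
  have [g gs cg] := hg w hw; exists (inl g); last exact: pconn.
  by rewrite map_f.
(* A new element between [x] and [y] forces [x <= a] and [b <= y]; one of the two is strict, and
   then [a] or [b] itself lies in the interval. *)
have /andP[xa by_] : ple x a && ple b y by move: hw; rewrite /between /plt /=.
have /orP[nx|ny] : (x != a) || (y != b) by rewrite -negb_and.
  have hba : between x y a.
    by rewrite /between (ple_neq_plt xa nx) (plt_ple_trans hP ab by_).
  have [g gs cg] := hg a hba; exists (inl g); first by rewrite map_f.
  apply: connect_trans (pconn _ _ cg); apply: connect1.
  by rewrite /between_rel hw /= (ple_refl hP) orbT andbT; exact: hba.
have hbb : between x y b.
  by rewrite /between (ple_plt_trans hP xa ab) ple_neq_plt // eq_sym.
have [g gs cg] := hg b hbb; exists (inl g); first by rewrite map_f.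
apply: connect_trans (pconn _ _ cg); apply: connect1.
by rewrite /between_rel hw /= (ple_refl hP) andbT; exact: hbb.
Qed.

(** What lies above a new element is in the new chain or above [b]. A nonempty interval starting
    there is thus part of the new chain, or contains [b], which is comparable to all its elements;
    dually with [a]. *)
Lemma adjunct_new_components_le (P : fposet) (a b : carrier P) (m k : nat)
    (Q := adjunct (chainP m.+1) a b) (i : 'I_m.+1) (x : carrier Q) :
  is_lattice P -> plt a b ->
  @components_le Q (inr i) x k.+1 /\ @components_le Q x (inr i) k.+1.
Proof.
case=> hP _ _ _ ab; case: x => [x|j]; last first.
  have tot j1 j2 : forall u v, @between Q (inr j1) (inr j2) u ->
      @between Q (inr j1) (inr j2) v -> @ple Q u v || @ple Q v u.
    move=> [u|u] [v|v]; rewrite /between /plt /= ?leq_total //.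
    - by move=> /andP[h h'] _; case: (pltF hP ab (ple_trans hP h h')).
    - by move=> /andP[h h'] _; case: (pltF hP ab (ple_trans hP h h')).
    - by move=> _ /andP[h h']; case: (pltF hP ab (ple_trans hP h h')).
  by split; apply: total_components_le; apply: tot.
split.
  have [->|nx] := eqVneq x b.
    apply: total_components_le => -[u|u] [v|v]; rewrite /between /plt /= ?leq_total //.
    - by move=> /andP[h /andP[n h']] _; case/eqP: n; congr inl; apply: ple_anti hP _ _ h' h.
    - by move=> /andP[h /andP[n h']] _; case/eqP: n; congr inl; apply: ple_anti hP _ _ h' h.
    - by move=> _ /andP[h /andP[n h']]; case/eqP: n; congr inl; apply: ple_anti hP _ _ h' h.
  have [bx|nbx] := boolP (ple b x).
    apply: (@hub_components_le Q _ _ (inl b)).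
      by rewrite /between /plt /= (ple_refl hP) bx andbT /=; apply: contraNneq nx => -[->].
    by move=> [u|u]; rewrite /between /plt /= ?(ple_refl hP) // => /andP[-> _]; rewrite orbT.
  apply: total_components_le => -[u|u] v; rewrite /between /plt /=.
    by move=> /andP[h /andP[_ h']]; case/negP: nbx; apply: (ple_trans hP h h').
  by move=> /andP[_ h]; rewrite h in nbx.
have [->|nx] := eqVneq x a.
  apply: total_components_le => -[u|u] [v|v]; rewrite /between /plt /= ?leq_total //.
  - by move=> /andP[/andP[n h] h'] _; case/eqP: n; congr inl; apply: ple_anti hP _ _ h h'.
  - by move=> /andP[/andP[n h] h'] _; case/eqP: n; congr inl; apply: ple_anti hP _ _ h h'.
  - by move=> _ /andP[/andP[n h] h']; case/eqP: n; congr inl; apply: ple_anti hP _ _ h h'.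
have [xa|nxa] := boolP (ple x a).
  apply: (@hub_components_le Q _ _ (inl a)).
    by rewrite /between /plt /= (ple_refl hP) xa !andbT /=; apply: contraNneq nx => -[->].
  by move=> [u|u]; rewrite /between /plt /= ?(ple_refl hP) ?orbT // => /andP[_ ->].
apply: total_components_le => -[u|u] v; rewrite /between /plt /=.
  by move=> /andP[/andP[_ h] h']; case/negP: nxa; apply: (ple_trans hP h h').
by move=> /andP[h _]; rewrite h in nxa.
Qed.

(* Adjoining a chain at (a, b) adds one component to that open interval; in any other interval
   that it meets, the new chain is connected to a or to b. *)
Lemma rep_components_le (Q : fposet) (rp : adj_rep Q) : rep_valid rp ->
  forall x y, components_le x y (count_mem (x, y) (rep_pairs rp)).+1.
Proof.
elim: rp => [m _ x y|P rp IH a b m [hv hL ab _]].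
  by apply: total_components_le => u v _ _; apply: leq_total.
have new k i u := @adjunct_new_components_le P a b m k i u hL ab.
case=> [x|i] y; last by case: (new (count_mem (inr i, y) (rep_pairs (RepAdj rp a b m))) i y).
case: y => [y|i]; last first.
  by case: (new (count_mem (inl x, inr i) (rep_pairs (RepAdj rp a b m))) i (inl x)).
have := @adjunct_components_le P a b m _ hL ab (IH hv) x y.
clear Q; set Q := adjunct _ a b.
have e : ((inl a : carrier Q, inl b : carrier Q) == (inl x, inl y)) = (x == a) && (y == b).
  by rewrite xpair_eqE (eq_sym x) (eq_sym y).
have c : count_mem (inl x : carrier Q, inl y : carrier Q)
    [seq (inl p.1, inl p.2) | p <- rep_pairs rp] = count_mem (x, y) (rep_pairs rp).
  by rewrite count_map; apply: eq_count => -[u v]; rewrite /= !xpair_eqE.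
congr components_le; rewrite /= -cats1 count_cat /= addn0 c e.
by rewrite addnS addnC.
Qed.

(** All that is kept of the distinctness of the adjunct pairs. Unlike a representation, it passes
    along isomorphisms. *)
Definition no_third (P : fposet) : Prop := forall a b z1 z2 w : carrier P,
  isolated a b z1 -> isolated a b z2 -> z1 != z2 -> plt a w -> plt w b ->
  w = z1 \/ w = z2.

(** No other element of the interval is comparable to [z], so the singleton of [z] is closed under
    [between_rel]. *)
Lemma isolated_component (P : fposet) (a b z g : carrier P) : is_poset P ->
  isolated a b z -> connect (between_rel a b) g z -> g = z.
Proof.
move=> hP /isolatedP[h1 h2 h3 h4].
have cl : closed (between_rel a b) (pred1 z).
  move=> x y; rewrite /between_rel /between !inE => /and3P[/andP[ax xb] /andP[ay yb] cmp].
  have key w : plt a w -> plt w b -> ple z w || ple w z -> w = z.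
    move=> aw wb /orP[] /ple_eqVlt[] // k.
      by case: (pltF hP wb (h3 _ k)).
    by case: (pltF hP aw (h4 _ k)).
  apply/eqP/eqP => e; subst; apply: key => //; by rewrite orbC.
by move=> /(closed_connect cl); rewrite !inE eqxx => /eqP.
Qed.

(** A pair that occurs at most once leaves at most two components in its interval, and [z1] and [z2]
    are two of them. *)
Lemma rep_no_third (Q : fposet) (rp : adj_rep Q) : is_poset Q ->
  rep_valid rp -> uniq (rep_pairs rp) -> no_third Q.
Proof.
move=> hQ hv hu a b z1 z2 w i1 i2 n12 aw wb.
have [s hs hg] := rep_components_le hv a b.
move: hs; rewrite count_uniq_mem // => hs.
have sym : connect_sym (between_rel a b).
  apply: sym_connect_sym => x y; rewrite /between_rel andbCA; congr [&& _, _ & _].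
  exact: orbC.
have mem z : isolated a b z -> z \in s.
  move=> hz; have /isolatedP[h1 h2 _ _] := hz.
  have [|g gs] := hg z; first by rewrite /between h1 h2.
  by rewrite sym => /(isolated_component hQ hz) <-.
have [|g gs cg] := hg w; first by rewrite /between aw wb.
case: (eqVneq g z1) => [e|n1].
  by left; apply: isolated_component i1 _ => //; rewrite -e.
case: (eqVneq g z2) => [e|n2].
  by right; apply: isolated_component i2 _ => //; rewrite -e.
have : size [:: g; z1; z2] <= size s.
  apply: uniq_leq_size; first by rewrite /= !inE (negbTE n1) (negbTE n2) n12.
  by move=> u; rewrite !inE => /or3P[] /eqP -> //; apply: mem.
by move=> /= h; have := leq_trans h hs; case: (_ \in _).
Qed.

Lemma no_third_iso (P Q : fposet) : iso P Q -> no_third Q -> no_third P.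
Proof.
case=> f [fbij fle] h a b z1 z2 w i1 i2 n12 aw wb.
have := h (f a) (f b) (f z1) (f z2) (f w).
rewrite !(isolated_iso fbij fle) !(plt_iso fbij fle) (inj_eq (bij_inj fbij)).
by case=> // /(bij_inj fbij) ->; [left | right].
Qed.

(** * Structure of fundamental basic blocks *)

Lemma is_lattice_dual (P : fposet) : is_lattice P -> is_lattice (dual P).
Proof. by case=> hP c0 hj hm; split=> //; apply: is_poset_dual. Qed.

(** The meet [m] of two upper covers [y] and [z] satisfies [x <= m < y], hence equals [x], and [x]
    would be reducible. *)
Lemma irreducible_up (P : fposet) (x : carrier P) :
  is_lattice P -> ~~ reducible x -> #|[pred y | covers x y]| <= 1.
Proof.
case=> hP _ _ hm nx; rewrite leqNgt; apply: contra nx => /card_gt1P[y [z []]].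
rewrite !inE => /andP[xy /forallP hy] /andP[xz /forallP hz] nyz.
have [m hmm] := hm y z; have /and3P[my mz /forallP h] := hmm.
have xm : ple x m by apply: (implyP (h x)); rewrite !pltW.
have ny : m != y.
  apply: contraNneq nyz => e; apply/eqP; move: mz; rewrite e => /ple_eqVlt[//|yz].
  by move: (hz y); rewrite xy yz.
suff em : x = m.
  move: hmm; rewrite -em => hmm.
  apply/existsP; exists y; apply/existsP; exists z; rewrite hmm orbT andbT.
  by case/andP: xy xz => + _ /andP[+ _]; rewrite ![x == _]eq_sym => -> ->.
case: (ple_eqVlt xm) => // xm'.
by move: (hy m); rewrite xm' (ple_neq_plt my ny).
Qed.

Lemma irreducible_dirr (P : fposet) (x : carrier P) :
  is_lattice P -> ~~ reducible x -> dirr x.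
Proof.
move=> hL nx; rewrite /dirr irreducible_up //=.
rewrite (eq_card (B := [pred y : carrier (dual P) | @covers (dual P) x y])).
  by apply: irreducible_up; [apply: is_lattice_dual | rewrite reducible_dual].
by move=> y; rewrite !inE covers_dual.
Qed.

(** A cover of [x] below [y] and one below [z] cannot coincide, since [x] is the greatest lower
    bound of [y] and [z]. *)
Lemma meet_not_dirr (P : fposet) (x y z : carrier P) : is_poset P ->
  y != x -> z != x -> is_meet y z x -> 1 < #|[pred y | covers x y]|.
Proof.
move=> hP ny nz /and3P[xy xz /forallP h].
have [c xc cy] : exists2 c, covers x c & ple c y.
  by apply: exists_upper_cover => //; apply: ple_neq_plt => //; rewrite eq_sym.
have [d xd dz] : exists2 c, covers x c & ple c z.
  by apply: exists_upper_cover => //; apply: ple_neq_plt => //; rewrite eq_sym.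
apply/card_gt1P; exists c, d; split=> //; apply/eqP => e; subst d.
case/andP: xc => /(pltF hP) k _; apply: k; apply: (implyP (h c)).
by rewrite cy dz.
Qed.

Lemma reducible_not_dirr (P : fposet) (x : carrier P) :
  is_poset P -> reducible x -> ~~ dirr x.
Proof.
move=> hP /existsP[y /existsP[z /and3P[ny nz /orP[hj|hm]]]]; rewrite /dirr negb_and -!ltnNge.
  apply/orP; right.
  have := @meet_not_dirr (dual P) x y z (is_poset_dual hP) ny nz hj.
  by congr (_ < _); apply: eq_card => w; rewrite !inE covers_dual.
by apply/orP; left; apply: meet_not_dirr ny nz hm.
Qed.

(** There is at most one upper and one lower cover of [x], removal loses no other covering, and at
    least one component remains. Together these bound the drop by one, so a drop of exactly one
    turns all of them into equalities. *)
Lemma nullity_drop (P : fposet) (x : carrier P) :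
  is_lattice P -> 1 < #|carrier P| -> dirr x ->
  nullity (remove x) = (nullity P - 1)%R ->
  [/\ exists b, covers x b, exists a, covers a x
    & forall u v : carrier (remove x), covers u v -> covers (val u) (val v)].
Proof.
move=> hL c1 /andP[hu hd]; rewrite (nullity_lattice hL) (card_covers_remove x).
have [hP _ _ _] := hL.
have c0 : 0 < #|carrier (remove x)| by move: c1; rewrite (card_remove x).
have /card_gt0P[x0 _] := c0; have := n_comp_gt0 x0.
rewrite /nullity (card_remove x).
have := subset_leqif_card (kept_covers_sub x); case.
set e0 := #|kept_covers x|; set e1 := #|[pred p : carrier (remove x) * _ | _]|.
set u := #|_| in hu *; set d := #|_| in hd *.
move=> le01 eq01 nc E.
have [eu [ed ee]] : u = 1 /\ d = 1 /\ e0 = e1 by lia.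
have in1 (A : pred (carrier P)) : #|A| = 1 -> exists y, A y.
  by move=> h; have /card_gt0P[y hy] : 0 < #|A|; [rewrite h | exists y].
split; [exact: (in1 [pred y | covers x y]) | exact: (in1 [pred y | covers y x]) |].
move=> p q pq; move/eqP: ee; rewrite eq01 => /subsetP/(_ (p, q)).
by rewrite !inE /=; apply.
Qed.

(** The order-theoretic content of being fundamental: the second condition records the drop of
    nullity, the third the distinct adjunct pairs. *)
Definition tight_spine (P : fposet) : Prop :=
  [/\ spine (@reducible P),
      forall a b z : carrier P, isolated a b z -> exists2 w, between a b w & w != z
    & no_third P].

Lemma card_le1_eq (T : finType) (A : pred T) (x y : T) :
  #|A| <= 1 -> A x -> A y -> x = y.
Proof. by move/card_le1_eqP => h hx hy; apply: h. Qed.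

Lemma fundamental_tight_spine (P : fposet) : fundamental P -> 0 < nred P -> tight_spine P.
Proof.
case=> [[hL tot] hB [Q [rp [hv _ hPQ hu]]]] /card_gt0P[r0]; rewrite inE => hr0.
have [hP _ _ _] := hL.
have c1 : 1 < #|carrier P|.
  case/existsP: hr0 => y /existsP[_ /and3P[ny _ _]].
  by apply/card_gt1P; exists y, r0.
have hdrop : forall x : carrier P, dirr x -> nullity (remove x) = (nullity P - 1)%R.
  case: hB => [e|h|//] x; first by move: c1; rewrite e.
  by move=> dx; move: (h x); rewrite dx.
(* If [z] were alone between [a] and [b], its removal would make [b] cover [a], a new covering that
   the drop of nullity forbids. *)
have fillin (a b z : carrier P) : isolated a b z -> exists2 w, between a b w & w != z.
  move=> hz; have nz := isolated_not_reducible hP hz.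
  have dz := irreducible_dirr hL nz.
  have [_ _ kept] := nullity_drop hL c1 dz (hdrop _ dz).
  have /isolatedP[az zb _ _] := hz.
  case: (pickP [pred w | between a b w && (w != z)]) => [w /andP[h1 h2]|none].
    by exists w.
  have na : a != z by case/andP: az.
  have nb : b != z by case/andP: zb; rewrite eq_sym.
  have : @covers (remove z) (Sub a na) (Sub b nb).
    rewrite /covers plt_remove (plt_trans hP az zb); apply/forallP => w.
    rewrite !plt_remove; have := none (val w); rewrite /= (valP w : val w != z) andbT.
    by rewrite /between => ->.
  by move/kept => /andP[_ /forallP/(_ z)]; rewrite /= az zb.
split=> //.
- split=> //; first by exists r0.
  move=> z nz; have dz := irreducible_dirr hL nz.
  have [[b zb] [a az] kept] := nullity_drop hL c1 dz (hdrop _ dz).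
  (* As [b] is the only upper cover of [z], everything strictly above [z] is above [b]; likewise
     below. *)
  have hz : isolated a b z.
    case/andP: (dz) => hu1 hd1; apply/isolatedP; split.
    + by case/andP: az.
    + by case/andP: zb.
    + move=> w /(exists_upper_cover hP)[c zc cw].
      by rewrite -(card_le1_eq hu1 zc zb).
    + move=> w /(exists_lower_cover hP)[c zc cw].
      by rewrite -(card_le1_eq hd1 zc az).
  have [w /andP[aw wb] wz] := fillin _ _ _ hz.
  exists a, b; split=> //.
    exact: isolated_reducible_low hz aw wb wz.
  exact: isolated_reducible_high hz aw wb wz.
- apply: (no_third_iso hPQ); apply: rep_no_third hv hu => //.
  by case: hPQ => f [fbij fle]; case: (is_lattice_iso fbij fle hL).
Qed.

(** * Coordinates with respect to a spine *)

(** With r_1 < ... < r_n the elements of [C], the values of [clow] and [cup] are i and n + 1 - i at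
    r_i, and i and n + 1 - j at an isolated element between r_i and r_j. Counting from the top makes
    [cup] the [clow] of the dual. *)
Definition clow (P : fposet) (C : pred (carrier P)) (x : carrier P) : nat :=
  #|[pred c | C c && ple c x]|.
Definition cup (P : fposet) (C : pred (carrier P)) (x : carrier P) : nat :=
  #|[pred c | C c && ple x c]|.

Section Keys.
Variables (P : fposet) (C : pred (carrier P)) (hS : spine C).
Local Notation n := #|[pred x | C x]|.

Let hP : is_poset P. Proof. by case: hS. Qed.

Lemma clow_le x y : ple x y -> clow C x <= clow C y.
Proof.
move=> xy; apply: subset_leq_card; apply/subsetP => c; rewrite !inE => /andP[-> cx].
exact: (ple_trans hP cx xy).
Qed.

Lemma clow_lt x y : C y -> plt x y -> clow C x < clow C y.
Proof.
move=> cy xy; apply/proper_card/properP; split.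
  apply/subsetP => c; rewrite !inE => /andP[-> cx]; exact: (ple_trans hP cx (pltW xy)).
exists y; rewrite !inE cy ?ple_refl //=; apply/negP; exact: (pltF hP xy).
Qed.

Lemma clow_mono x y : C x -> C y -> clow C x <= clow C y -> ple x y.
Proof.
move=> cx cy le; have [_ tot _ _] := hS; case/orP: (tot _ _ cx cy) => // /ple_eqVlt[->|].
  exact: ple_refl.
by move/(clow_lt cx); rewrite ltnNge le.
Qed.

Lemma clow_inj x y : C x -> C y -> clow C x = clow C y -> x = y.
Proof.
by move=> cx cy e; apply: (ple_anti hP); apply: clow_mono => //; rewrite e.
Qed.

Lemma clow_gt0 x : 0 < clow C x.
Proof.
have [_ _ _ hz] := hS; apply/card_gt0P.
have [cx|/hz[a [b [ca cb /isolatedP[ax _ _ _]]]]] := boolP (C x).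
  by exists x; rewrite !inE cx ple_refl.
by exists a; rewrite !inE ca pltW.
Qed.

Lemma clow_isolated a b z : C a -> ~~ C z -> isolated a b z -> clow C z = clow C a.
Proof.
move=> ca nz /isolatedP[az _ _ h]; apply/eqP; rewrite eqn_leq (clow_le (pltW az)) andbT.
apply: subset_leq_card; apply/subsetP => c; rewrite !inE => /andP[cc cz].
rewrite cc; apply: h; apply: ple_neq_plt => //; by apply: contraNneq nz => <-.
Qed.

(** Each spine element is comparable to [x], and only [x] is counted twice. Off the spine the sum is
    at most [n], so the sum recognises the spine. *)
Lemma clow_cup_in x : C x -> clow C x + cup C x = n.+1.
Proof.
move=> cx; have [_ tot _ _] := hS; rewrite /clow /cup -cardUI -addn1; congr addn.
  apply: eq_card => c; rewrite !inE -andb_orr.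
  by case cc: (C c) => //=; apply: tot.
rewrite -(card1 x); apply: eq_card => c; rewrite !inE.
apply/andP/eqP => [[/andP[_ h1] /andP[_ h2]]|->]; first exact: (ple_anti hP).
by rewrite cx (ple_refl hP).
Qed.

Lemma clow_cup_out x : ~~ C x -> clow C x + cup C x <= n.
Proof.
move=> nx; rewrite /clow /cup -cardUI [X in _ + X]eq_card0 ?addn0.
  by apply: subset_leq_card; apply/subsetP => c; rewrite !inE => /orP[] /andP[].
move=> c; rewrite !inE; apply/negP => /andP[/andP[cc h1] /andP[_ h2]].
by case/negP: nx; rewrite -(ple_anti hP h1 h2).
Qed.

(** By pigeonhole among the [n] spine elements, the sum exceeds [n] exactly when one of them lies
    between [x] and [y]. The coordinates thus recover the order on distinct elements. *)
Lemma spine_key x y : ple x y = (x == y) || (n < clow C y + cup C x).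
Proof.
have [_ tot _ hz] := hS; apply/idP/orP => [xy|[/eqP->|]].
- case: (ple_eqVlt xy) => [->|pxy]; first by left.
  right; have [r [cr xr ry]] : exists r, [/\ C r, ple x r & ple r y].
    have [cx|/hz[a [b [ca cb /isolatedP[_ xb h _]]]]] := boolP (C x).
      by exists x; rewrite ple_refl.
    by exists b; rewrite pltW ?h.
  have := clow_cup_in cr; have := clow_le ry.
  suff : cup C r <= cup C x by lia.
  apply: subset_leq_card; apply/subsetP => c; rewrite !inE => /andP[-> rc].
  exact: (ple_trans hP xr rc).
- exact: ple_refl.
- rewrite /clow /cup -cardUI; set U := [predU _ & _]; set I := [predI _ & _] => lt.
  have leU : #|U| <= n.
    by apply: subset_leq_card; apply/subsetP => c; rewrite !inE => /orP[] /andP[].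
  have : 0 < #|I| by rewrite lt0n; apply: contraTneq lt => ->; rewrite addn0 -leqNgt.
  case/card_gt0P=> c; rewrite !inE => /andP[/andP[_ cy] /andP[_ xc]].
  exact: (ple_trans hP xc cy).
Qed.

(** [clow] is injective on the [n] spine elements and takes values from 1 to [n]. *)
Lemma clow_surj p : 0 < p <= n -> exists2 c, C c & clow C c = p.
Proof.
move=> hp; pose s := map (clow C) (enum [pred x | C x]).
have us : uniq s.
  rewrite map_inj_in_uniq ?enum_uniq // => x y; rewrite !mem_enum !inE => cx cy.
  exact: clow_inj.
have sub : {subset s <= iota 1 n}.
  move=> q /mapP[x]; rewrite mem_enum inE => cx ->; rewrite mem_iota clow_gt0 add1n ltnS.
  by apply: subset_leq_card; apply/subsetP => c; rewrite !inE => /andP[].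
have [|_ e] := uniq_min_size us sub; first by rewrite size_iota size_map -cardE.
have : p \in s by rewrite e mem_iota; lia.
by case/mapP => c; rewrite mem_enum inE => cc ->; exists c.
Qed.

(* A spine element with no isolated element attached above has a next element
   below everything above it, so it is not a meet. *)
Lemma spine_meet_attached r y w :
  C r -> y != r -> w != r -> is_meet y w r ->
  exists b z, isolated r b z /\ ~~ C z.
Proof.
move=> cr ny nw /and3P[ry rw /forallP hm]; have [_ tot _ hz] := hS.
have step v : v != r -> ple r v ->
    (exists b z, isolated r b z /\ ~~ C z) \/ exists r', [/\ C r', plt r r' & ple r' v].
  move=> nv rv; have prv : plt r v by apply: ple_neq_plt => //; rewrite eq_sym.
  have [cv|nCv] := boolP (C v); first by right; exists v; rewrite ple_refl.
  have [a [b [ca cb hv]]] := hz _ nCv; have /isolatedP[av _ _ h] := hv.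
  case: (ple_eqVlt (h _ prv)) => [e|ra].
    by left; exists b, v; rewrite e.
  by right; exists a; rewrite ca ra pltW.
case: (step _ ny ry) => // -[r1 [c1 l1 k1]].
case: (step _ nw rw) => // -[r2 [c2 l2 k2]].
case/orP: (tot _ _ c1 c2) => k.
  by case: (pltF hP l1 (implyP (hm r1) _)); rewrite k1 (ple_trans hP k k2).
by case: (pltF hP l2 (implyP (hm r2) _)); rewrite k2 (ple_trans hP k k1).
Qed.

End Keys.

Section KeysDual.
Variables (P : fposet) (C : pred (carrier P)) (hS : spine C).
Local Notation n := #|[pred x | C x]|.
Let hSd := spine_dual hS.

Lemma cup_le x y : ple x y -> cup C y <= cup C x.
Proof. exact: (@clow_le (dual P) C hSd y x). Qed.

Lemma cup_lt x y : C x -> plt x y -> cup C y < cup C x.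
Proof. by move=> cx xy; apply: (@clow_lt (dual P) C hSd y x) => //; rewrite plt_dual. Qed.

Lemma cup_mono x y : C x -> C y -> cup C y <= cup C x -> ple x y.
Proof. by move=> cx cy; apply: (@clow_mono (dual P) C hSd y x). Qed.

Lemma cup_inj x y : C x -> C y -> cup C x = cup C y -> x = y.
Proof. exact: (@clow_inj (dual P) C hSd x y). Qed.

Lemma cup_gt0 x : 0 < cup C x.
Proof. exact: (@clow_gt0 (dual P) C hSd x). Qed.

Lemma cup_isolated a b z : C b -> ~~ C z -> isolated a b z -> cup C z = cup C b.
Proof.
by move=> cb nz hz; apply: (@clow_isolated (dual P) C hSd b a z) => //; rewrite isolated_dual.
Qed.

Lemma spine_join_attached r y w :
  C r -> y != r -> w != r -> is_join y w r ->
  exists a z, isolated a r z /\ ~~ C z.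
Proof.
move=> cr ny nw hj.
have [b [z [h k]]] := @spine_meet_attached (dual P) C hSd r y w cr ny nw hj.
by exists b, z; rewrite -isolated_dual.
Qed.

End KeysDual.

(** * Elements with given coordinates *)

Definition fiber (P : fposet) (p q : nat) : pred (carrier P) :=
  [pred x | (clow (@reducible P) x == p) && (cup (@reducible P) x == q)].

Section TightSpine.
Variables (P : fposet) (hG : tight_spine P).
Local Notation R := (@reducible P).
Local Notation n := (nred P).

Let hS : spine R. Proof. by case: hG. Qed.
Let hP : is_poset P. Proof. by case: hS. Qed.

(** The coordinates of an irreducible element fix its two ends, and their sum keeps reducible
    elements out of the fiber. *)
Lemma fiber_isolated p q x a b : fiber p q x -> R a -> R b -> isolated a b x ->
  forall y, fiber p q y = isolated a b y.
Proof.
move=> /andP[/eqP xp /eqP xq] Ra Rb hx y.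
have nx := isolated_not_reducible hP hx.
have lx := clow_isolated hS Ra nx hx; have ux := cup_isolated hS Rb nx hx.
apply/idP/idP => [/andP[/eqP yp /eqP yq]|hy].
  have [Ry|ny] := boolP (R y).
    by have := clow_cup_in hS Ry; have := clow_cup_out hS nx; lia.
  have [_ _ _ hz] := hS; have [a' [b' [Ra' Rb' hy]]] := hz y ny.
  have ly := clow_isolated hS Ra' ny hy; have uy := cup_isolated hS Rb' ny hy.
  have ea : a = a' by apply: (clow_inj hS) => //; lia.
  have eb : b = b' by apply: (cup_inj hS) => //; lia.
  by rewrite ea eb.
have ny := isolated_not_reducible hP hy.
rewrite /fiber /= (clow_isolated hS Ra ny hy) (cup_isolated hS Rb ny hy).
by rewrite -lx -ux xp xq !eqxx.
Qed.

(** For an isolated element between r_i and r_j, p = i and q = n + 1 - j, so [p + q == n] means j =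
    i + 1. *)
Lemma fiber_card p q :
  #|@fiber P p q| =
  if [exists x, @fiber P p q x] then if p + q == n then 2 else 1 else 0.
Proof.
case: ifPn => [/existsP[x hx]|]; last first.
  by rewrite negb_exists => /forallP h; apply: eq_card0 => x; rewrite inE; apply/negbTE/h.
have /andP[/eqP xp /eqP xq] := hx; have [_ _ _ hz] := hS.
have [_ fillin third] := hG.
have [Rx|nx] := boolP (R x).
  have sx := clow_cup_in hS Rx; rewrite ifF; last by rewrite /nred; lia.
  rewrite -(card1 x); apply: eq_card => y; rewrite !inE; apply/andP/eqP => [[/eqP yp /eqP yq]|->].
    have [Ry|ny] := boolP (R y); first by apply: (clow_inj hS) => //; lia.
    by have := clow_cup_out hS ny; lia.
  by rewrite xp xq.
have [a [b [Ra Rb hi]]] := hz x nx; have fib := fiber_isolated hx Ra Rb hi.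
have la := clow_isolated hS Ra nx hi; have ub := cup_isolated hS Rb nx hi.
have sx := clow_cup_out hS nx.
have [w /andP[aw wb] wx] := fillin _ _ _ hi.
case: ifPn => [/eqP pq|npq].
  (* No reducible element fits between consecutive [a] and [b], so [w] is a second element of the
     fiber, and [third] allows no more. *)
  have nw : ~~ R w.
    apply/negP => Rw; have := clow_cup_in hS Rw.
    have := clow_lt hS Rw aw; have := cup_lt hS Rw wb; rewrite /nred in pq; lia.
  have hw : isolated a b w.
    rewrite -fib; have := clow_le hS (pltW aw); have := cup_le hS (pltW wb).
    have := clow_cup_out hS nw; rewrite /nred in pq; rewrite /fiber /= => *.
    apply/andP; split; apply/eqP; lia.
  transitivity #|pred2 x w|; last by rewrite card2 eq_sym wx.
  apply: eq_card => y; rewrite !inE [X in X = _]fib; apply/idP/orP => [hy|[]/eqP-> //].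
  have /isolatedP[ay yb _ _] := hy.
  by case: (third _ _ _ _ _ hi hw _ ay yb) => [|->|->]; rewrite 1?eq_sym //; [left|right].
(* The spine element just after [a] lies strictly between [a] and [b]; with it there, a second
   element of the fiber would violate [third]. *)
have [|r Rr lr] := @clow_surj _ _ hS p.+1; first by rewrite /nred in npq; lia.
have ur := clow_cup_in hS Rr.
have ar : plt a r.
  apply: ple_neq_plt; first by apply: (clow_mono hS) => //; lia.
  by apply/eqP => e; move: lr; rewrite -e; lia.
have rb : plt r b.
  apply: ple_neq_plt; first by apply: (cup_mono hS) => //; rewrite /nred in npq; lia.
  by apply/eqP => e; rewrite -e in ub; rewrite /nred in npq; lia.
rewrite -(card1 x); apply: eq_card => y; rewrite !inE [X in X = _]fib.
apply/idP/eqP => [hy|-> //]; apply/eqP/negPn/negP => yx.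
case: (third _ _ _ _ _ hi hy _ ar rb) => [|e|e]; first by rewrite eq_sym.
  by move: nx; rewrite -e Rr.
by have := isolated_not_reducible hP hy; rewrite -e Rr.
Qed.

(** Beyond sum [n] only spine elements occur, all with sum [n.+1], so these fibers depend on [n]
    alone. *)
Lemma fiber_exists_gt p q : n < p + q ->
  [exists x, @fiber P p q x] = [&& 0 < p, 0 < q & p + q == n.+1].
Proof.
move=> lt; apply/existsP/and3P => [[x /andP[/eqP xp /eqP xq]]|[p0 q0 /eqP e]].
  rewrite -xp -xq (clow_gt0 hS) (cup_gt0 hS); split=> //.
  have [Rx|nx] := boolP (R x); first by rewrite (clow_cup_in hS Rx).
  by have := clow_cup_out hS nx; rewrite /nred in lt; lia.
have [|r Rr lr] := @clow_surj _ _ hS p; first by rewrite /nred in e; lia.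
exists r; have := clow_cup_in hS Rr; rewrite /fiber /= lr eqxx /=.
rewrite /nred in e; lia.
Qed.

(** This is why the associated graph has no isolated vertex: [z] shares a coordinate with [r], so
    its edge ends at [r]. *)
Lemma reducible_attached r : R r -> exists2 z, ~~ R z
  & clow R z = clow R r \/ cup R z = cup R r.
Proof.
move=> Rr; have /existsP[y /existsP[w /and3P[ny nw /orP[hj|hm]]]] := Rr.
  have [a [z [hz nz]]] := spine_join_attached hS Rr ny nw hj.
  by exists z => //; right; apply: cup_isolated hz.
have [b [z [hz nz]]] := spine_meet_attached hS Rr ny nw hm.
by exists z => //; left; apply: clow_isolated hz.
Qed.

End TightSpine.

(** * Reconstruction from the fibers *)

(** An element goes to the one of the same rank in the enumeration of the corresponding fiber; the
    two given elements are the defaults of [nth]. *)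
Lemma fiber_bijection (T T' : finType) (K : eqType) (k : T -> K) (k' : T' -> K) :
  T -> T' ->
  (forall v, #|[pred x | k x == v]| = #|[pred x | k' x == v]|) ->
  exists2 f : T -> T', bijective f & forall x, k' (f x) = k x.
Proof.
move=> t0 t0' h; pose s v := enum [pred x | k x == v].
pose s' v := enum [pred x | k' x == v].
have sz v : size (s v) = size (s' v) by rewrite -!cardE h.
pose f x := nth t0' (s' (k x)) (index x (s (k x))).
pose g y := nth t0 (s (k' y)) (index y (s' (k' y))).
have ms x : x \in s (k x) by rewrite mem_enum inE.
have ms' y : y \in s' (k' y) by rewrite mem_enum inE.
have kf x : k' (f x) = k x.
  have : f x \in s' (k x) by rewrite mem_nth // -sz index_mem.
  by rewrite mem_enum inE => /eqP.
have kg y : k (g y) = k' y.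
  have : g y \in s (k' y) by rewrite mem_nth // sz index_mem.
  by rewrite mem_enum inE => /eqP.
exists f => //; exists g => [x|y].
  rewrite /g kf /f index_uniq ?enum_uniq ?nth_index // -sz index_mem //.
rewrite /f kg /g index_uniq ?enum_uniq ?nth_index // sz index_mem //.
Qed.

(** Fibers of equal size give a bijection that keeps coordinates, and by [spine_key] the coordinates
    determine the order. *)
Lemma tight_spine_iso (P Q : fposet) : tight_spine P -> tight_spine Q -> nred P = nred Q ->
  (forall p q, p + q <= nred P ->
     [exists x, @fiber P p q x] = [exists x, @fiber Q p q x]) ->
  iso P Q.
Proof.
move=> gP gQ en hk; have [sP _ _] := gP; have [sQ _ _] := gQ.
have [_ _ [x0 _] _] := sP; have [_ _ [y0 _] _] := sQ.
pose kP (x : carrier P) := (clow (@reducible P) x, cup (@reducible P) x).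
pose kQ (x : carrier Q) := (clow (@reducible Q) x, cup (@reducible Q) x).
have [[p q]|f fbij fk] := @fiber_bijection _ _ _ kP kQ x0 y0.
  have -> : #|[pred x | kP x == (p, q)]| = #|@fiber P p q| by apply: eq_card.
  have -> : #|[pred x | kQ x == (p, q)]| = #|@fiber Q p q| by apply: eq_card.
  rewrite !fiber_card // -en; case: (leqP (p + q) (nred P)) => [/hk -> //|lt].
  by rewrite !fiber_exists_gt // -en.
exists f; split=> // x y; rewrite (spine_key sP) (spine_key sQ) (inj_eq (bij_inj fbij)).
case: (fk x) => _ ->; case: (fk y) => -> _.
by rewrite -[#|[pred x | reducible x]|]/(nred Q) -[#|[pred x | reducible x]|]/(nred P) en.
Qed.

Lemma fiber_exists_iso (P Q : fposet) p q : iso P Q ->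
  [exists x, @fiber P p q x] = [exists x, @fiber Q p q x].
Proof.
case=> f [fbij fle]; rewrite [RHS](existsb_bij fbij); apply: eq_existsb => x.
rewrite /fiber /= /clow /cup.
rewrite (card_bij fbij [pred c | reducible c && ple c (f x)]).
rewrite (card_bij fbij [pred c | reducible c && ple (f x) c]).
by congr andb; congr (_ == _); apply: eq_card => c; rewrite !inE /= (reducible_iso fbij fle) fle.
Qed.

(** * The block of a graph *)

Lemma card_ord_lt n k : k <= n -> #|[pred i : 'I_n | i < k]| = k.
Proof.
move=> kn; rewrite -[RHS](card_ord k).
have inj : injective (widen_ord kn) by move=> i j /(congr1 val) /= /val_inj.
rewrite -(card_codom inj); apply: eq_card => i; rewrite !inE.
apply/idP/codomP => [ik|[j ->]]; last exact: (ltn_ord j).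
by exists (Ordinal ik); apply: val_inj.
Qed.

Lemma card_ord_ge n k : k <= n -> #|[pred i : 'I_n | k <= i]| = n - k.
Proof.
move=> kn; rewrite -[X in X - k](card_ord n) -(cardC [pred i : 'I_n | i < k]).
by rewrite card_ord_lt // addKn; apply: eq_card => i; rewrite !inE -leqNgt.
Qed.

Lemma set2_ltn_inj n (i j i' j' : 'I_n) : i < j -> i' < j' ->
  [set i; j] = [set i'; j'] -> i = i' /\ j = j'.
Proof.
move=> ij ij' /setP e; have := e i; have := e j; have := e i'; have := e j'.
rewrite !inE !eqxx /= !orbT.
move=> /orP h1 /orP h2 /esym/orP h3 /esym/orP h4.
by split; apply: val_inj; case: h1; case: h2; case: h3; case: h4;
  move=> /eqP e1 /eqP e2 /eqP e3 /eqP e4; subst; lia.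
Qed.

Lemma edge_ends n (e : {set 'I_n}) : #|e| = 2 -> exists i j : 'I_n, i < j /\ e = [set i; j].
Proof.
move=> /eqP/cards2P[x [y [xy ->]]].
case: (ltngtP x y) => [h|h|/val_inj h]; first by exists x, y.
  by exists y, x; rewrite setUC.
by rewrite h eqxx in xy.
Qed.

(* [(i, i, false)] is the i-th reducible element, [(i, j, false)] the element adjoined
   for the edge [ij], and [(i, i.+1, true)] the twin that keeps [i.+1] from covering [i]. *)
Definition block_cond n (G : {set {set 'I_n}}) (p : 'I_n * 'I_n * bool) : bool :=
  if p.1.1 == p.1.2 then ~~ p.2
  else [&& p.1.1 < p.1.2, [set p.1.1; p.1.2] \in G & p.2 ==> (p.1.2 == p.1.1.+1 :> nat)].

(** An interval order in which the elements [(i, i, false)] are degenerate intervals. Equality is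
    added because a proper interval does not precede itself. *)
Definition block n (G : {set {set 'I_n}}) : fposet :=
  @FPoset {p : 'I_n * 'I_n * bool | block_cond G p}
    (fun x y => (x == y) || ((val x).1.2 <= (val y).1.1)).

Section Block.
Variables (n : nat) (G : {set {set 'I_n}}).
Local Notation T := (carrier (block G)).

Definition lo (x : T) : 'I_n := (val x).1.1.
Definition hi (x : T) : 'I_n := (val x).1.2.
Definition twin (x : T) : bool := (val x).2.
Definition point (x : T) : bool := lo x == hi x.
(** The maximal chain of the representation: when [i] and [i.+1] are joined, the twin goes into the
    chain and the other element is adjoined, which leaves one element off the chain per edge. *)
Definition chain0 (x : T) : bool := point x || twin x.

Lemma block_ext x y : lo x = lo y -> hi x = hi y -> twin x = twin y -> x = y.
Proof.
case: x y => [[[i j] t] hx] [[[i' j'] t'] hy]; rewrite /lo /hi /twin /= => e1 e2 e3.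
by apply: val_inj; rewrite /= e1 e2 e3.
Qed.

Lemma block_valP x :
  if point x then ~~ twin x
  else [&& lo x < hi x, [set lo x; hi x] \in G & twin x ==> (hi x == (lo x).+1 :> nat)].
Proof. exact: (valP x). Qed.

Lemma point_twin x : point x -> twin x = false.
Proof.
by move=> px; have := block_valP x; rewrite px => /negbTE.
Qed.

Lemma nonpoint x : ~~ point x ->
  [/\ lo x < hi x, [set lo x; hi x] \in G & twin x -> hi x = (lo x).+1 :> nat].
Proof.
by have := block_valP x; case: ifP => // _ /and3P[h1 h2 h3] _;
  split=> // t; move: h3; rewrite t => /eqP.
Qed.

Lemma lo_le_hi x : lo x <= hi x.
Proof.
have [/eqP->//|/nonpoint[h _ _]] := boolP (point x); exact: ltnW.
Qed.

Lemma block_ple x y : ple x y = (x == y) || (hi x <= lo y).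
Proof. by []. Qed.

Lemma point_inj x y : point x -> point y -> lo x = lo y -> x = y.
Proof.
move=> px py e; apply: block_ext => //; last by rewrite !point_twin.
by rewrite -(eqP px) -(eqP py).
Qed.

Lemma block_poset : is_poset (block G).
Proof.
split.
- by move=> x; rewrite block_ple eqxx.
- move=> x y; rewrite !block_ple (eq_sym y); case: eqVneq => //= _ /andP[h k].
  have lx := lo_le_hi x; have ly := lo_le_hi y.
  by apply: point_inj; [apply/eqP | apply/eqP |]; apply: val_inj => /=; lia.
- move=> y x z; rewrite !block_ple => /orP[/eqP-> //|h] /orP[/eqP<-|k].
    by rewrite h orbT.
  by have := lo_le_hi y => ly; rewrite (_ : (hi x <= lo z)) ?orbT //; lia.
Qed.

Lemma block_plt x y : plt x y = (x != y) && (hi x <= lo y).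
Proof. by rewrite /plt block_ple; case: (x == y). Qed.

Lemma pt_proof i : block_cond G (i, i, false).
Proof. by rewrite /block_cond /= eqxx. Qed.

Definition pt i : T := Sub (i, i, false) (pt_proof i).

Lemma point_pt i : point (pt i).
Proof. by rewrite /point /lo /hi /= eqxx. Qed.

Lemma pt_inj : injective pt.
Proof. by move=> i j /(congr1 lo). Qed.

Lemma point_lo x : point x -> x = pt (lo x).
Proof. by move=> px; apply: point_inj => //; apply: point_pt. Qed.

Lemma pt_neq i x : ~~ point x -> pt i != x.
Proof. by apply: contraNneq => <-; apply: point_pt. Qed.

Lemma nonpoint_isolated x : ~~ point x -> isolated (pt (lo x)) (pt (hi x)) x.
Proof.
move=> nx; have [lt _ _] := nonpoint nx; apply/isolatedP; split.
- by rewrite block_plt pt_neq //= leqnn.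
- by rewrite block_plt eq_sym pt_neq //= leqnn.
- by move=> w; rewrite block_plt => /andP[_ h]; rewrite block_ple h orbT.
- by move=> w; rewrite block_plt => /andP[_ h]; rewrite block_ple h orbT.
Qed.

(** If [hi x] follows [lo x], the witness is the other element of the twin pair; otherwise it is the
    point just after [lo x]. The last conclusion supplies the chain element that [adjunct_spine]
    asks for. *)
Lemma nonpoint_between x : ~~ point x ->
  exists w, [/\ between (pt (lo x)) (pt (hi x)) w, w != x & ~~ twin x -> chain0 w].
Proof.
move=> nx; have [lt inG tw] := nonpoint nx.
have nlh : (lo x == hi x) = false by rewrite -val_eqE /=; lia.
have [e|ne] := eqVneq (val (hi x)) (val (lo x)).+1.
  have pw : block_cond G (lo x, hi x, ~~ twin x).
    by rewrite /block_cond /= nlh lt inG e eqxx implybT.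
  pose w : T := Sub (lo x, hi x, ~~ twin x) pw.
  have nw : ~~ point w by rewrite /point /lo /hi /= -/(lo x) -/(hi x) nlh.
  exists w; split.
  - by have /isolatedP[h1 h2 _ _] := nonpoint_isolated nw; rewrite /between h1 h2.
  - apply/eqP => /(congr1 twin); rewrite /twin /= -/(twin x); by case: (twin x).
  - by rewrite /chain0 /twin /= => ->; rewrite orbT.
have ln : (lo x).+1 < n by have := ltn_ord (hi x); lia.
exists (pt (Ordinal ln)); split.
- rewrite /between !block_plt !(inj_eq pt_inj) -!val_eqE /=.
  by move: ne lt; rewrite /lo /hi /=; lia.
- exact: pt_neq.
- by rewrite /chain0 point_pt.
Qed.

Lemma point_total x y : point x -> point y -> ple x y || ple y x.
Proof.
move=> px py; rewrite !block_ple -(eqP px) -(eqP py).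
by case/orP: (leq_total (lo x) (lo y)) => ->; rewrite ?orbT.
Qed.

Lemma point_spine : 0 < n -> spine point.
Proof.
move=> n0; split; first exact: block_poset.
- exact: point_total.
- by exists (pt (Ordinal n0)); apply: point_pt.
- move=> z nz; exists (pt (lo z)), (pt (hi z)); rewrite !point_pt; split=> //.
  exact: nonpoint_isolated.
Qed.

(** Elements of [chain0] are intervals of length at most one, and the length decides [twin], so they
    are determined by their ends. *)
Lemma chain0_total x y : chain0 x -> chain0 y -> ple x y || ple y x.
Proof.
have key z : chain0 z -> hi z <= (lo z).+1 /\ (lo z == hi z) = ~~ twin z.
  have [pz _|nz] := boolP (point z).
    by rewrite (point_twin pz) -(eqP pz) eqxx leqnSn.
  rewrite /chain0 (negbTE nz) /= => tz; have [_ _ h] := nonpoint nz.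
  by rewrite (h tz) leqnn tz; split=> //; apply: negbTE.
move=> /key[hx px] /key[hy py]; rewrite !block_ple (eq_sym y).
have lx := lo_le_hi x; have ly := lo_le_hi y.
have [//|nxy] := eqVneq x y; rewrite /=.
case: (ltngtP (lo x) (lo y)) => [h|h|/val_inj h].
- by rewrite (leq_trans hx h).
- by rewrite (leq_trans hy h) orbT.
case: (ltngtP (hi x) (hi y)) => [k|k|/val_inj k].
- by rewrite (_ : hi x <= lo y) //; move: h k hx hy => /(congr1 val) /=; lia.
- by rewrite (_ : hi y <= lo x) ?orbT //; move: h k hx hy => /(congr1 val) /=; lia.
case/eqP: nxy; apply: block_ext => //.
by apply: (can_inj negbK); rewrite -px -py h k.
Qed.

Lemma chain0_adjunct_spine : 0 < n -> adjunct_spine chain0.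
Proof.
move=> n0; split; first exact: block_poset.
- exact: chain0_total.
- by exists (pt (Ordinal n0)); rewrite /chain0 point_pt.
- move=> z; rewrite /chain0 negb_or => /andP[nz ntz].
  have [w [hw _ cw]] := nonpoint_between nz.
  exists (pt (lo z)), (pt (hi z)), w; rewrite !point_pt; split=> //; first exact: cw.
  exact: nonpoint_isolated.
Qed.

Lemma chain0_distinct (a b z z' : T) : ~~ chain0 z -> ~~ chain0 z' ->
  isolated a b z -> isolated a b z' -> z = z'.
Proof.
rewrite /chain0 !negb_or => /andP[nz tz] /andP[nz' tz'] hz hz'.
have [ea eb] := isolated_unique block_poset hz (nonpoint_isolated nz).
have [ea' eb'] := isolated_unique block_poset hz' (nonpoint_isolated nz').
apply: block_ext; [apply: pt_inj; congruence | apply: pt_inj; congruence |].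
by rewrite (negbTE tz) (negbTE tz').
Qed.

Lemma block_nonpoint_irreducible x : reducible x -> point x.
Proof.
move=> rx; apply/negPn/negP => nx.
by have := isolated_not_reducible block_poset (nonpoint_isolated nx); rewrite rx.
Qed.

Lemma block_nullity : 0 < n -> (forall e, e \in G -> #|e| = 2) ->
  nullity (block G) = Posz #|G|.
Proof.
move=> n0 h2; rewrite (adjunct_spine_nullity (chain0_adjunct_spine n0)); congr Posz.
pose A := [set x : T | ~~ chain0 x].
rewrite (_ : #|_| = #|A|); last by apply: eq_card => x; rewrite !inE.
pose F (x : T) := [set lo x; hi x].
have inj : {in A &, injective F}.
  move=> x y; rewrite !inE /chain0 !negb_or => /andP[nx tx] /andP[ny ty].
  have [lx _ _] := nonpoint nx; have [ly _ _] := nonpoint ny.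
  move=> /(set2_ltn_inj lx ly)[e1 e2]; apply: block_ext => //.
  by rewrite (negbTE tx) (negbTE ty).
rewrite -(card_in_imset inj); apply: eq_card => e; apply/imsetP/idP => [[x]|he].
  by rewrite inE negb_or => /andP[nx _] ->; have [] := nonpoint nx.
have [i [j [ij ee]]] := edge_ends (h2 e he).
have nij : (i == j) = false by rewrite -val_eqE /=; lia.
have px : block_cond G (i, j, false) by rewrite /block_cond /= nij ij -ee he.
by exists (Sub (i, j, false) px); rewrite // inE /chain0 /point /lo /hi /twin /= nij.
Qed.

End Block.

(** * Blocks of graphs without isolated vertices *)

Lemma DsetP n l (G : {set {set 'I_n}}) :
  reflect [/\ forall e, e \in G -> #|e| = 2, #|G| = l
            & forall v : 'I_n, exists2 e, e \in G & v \in e] (G \in Dset n l).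
Proof.
rewrite inE; apply: (iffP and3P) => [[h1 /eqP h2 h3]|[h1 h2 h3]]; split=> //.
- by move=> e he; apply/eqP; apply: (implyP (forallP h1 e)).
- by move=> v; have /existsP[e /andP[he hv]] := forallP h3 v; exists e.
- by apply/forallP => e; apply/implyP => /h1 ->.
- exact/eqP.
- apply/forallP => v; have [e he hv] := h3 v; apply/existsP; exists e.
  by rewrite he hv.
Qed.

Section BlockD.
Variables (n l : nat) (G : {set {set 'I_n}}).
Hypothesis hG : G \in Dset n l.
Local Notation T := (carrier (block G)).

(** A vertex [v] lies on an edge; the element adjoined for this edge has [pt v] as an end and is not
    alone in its interval, so [pt v] is a meet or a join. *)
Lemma block_reducible (x : T) : reducible x = point x.
Proof.
apply/idP/idP; first exact: block_nonpoint_irreducible.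
move=> px; rewrite (point_lo px); move: (lo x) => v {x px}.
have [h2 _ h] := DsetP _ _ hG; have [e he hv] := h v.
have [i [j [ij ee]]] := edge_ends (h2 e he).
have nij : (i == j) = false by rewrite -val_eqE /=; lia.
have pz : block_cond G (i, j, false) by rewrite /block_cond /= nij ij -ee he.
pose z : T := Sub (i, j, false) pz.
have nz : ~~ point z by rewrite /point /lo /hi /= nij.
have [w [/andP[aw wb] wz _]] := nonpoint_between nz.
have hz := nonpoint_isolated nz.
move: hv; rewrite ee !inE => /orP[]/eqP ->.
  exact: (isolated_reducible_low (block_poset G) hz aw wb wz).
exact: (isolated_reducible_high (block_poset G) hz aw wb wz).
Qed.

Lemma card_points (q : pred 'I_n) : #|[pred x : T | point x && q (lo x)]| = #|q|.
Proof.
rewrite -(card_image (@pt_inj n G)); apply: eq_card => x; rewrite !inE.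
apply/andP/imageP => [[px qx]|[i qi ->]]; last by rewrite point_pt.
by exists (lo x) => //; apply: point_lo.
Qed.

Lemma block_nred : nred (block G) = n.
Proof.
rewrite /nred -[RHS]card_ord -(card_points predT); apply: eq_card => x.
by rewrite !inE block_reducible andbT.
Qed.

(** Vertices are numbered from 0, whence the successor here and the plain difference [n - hi x] in
    [block_cup]. *)
Lemma block_clow (x : T) : clow (@reducible (block G)) x = (lo x).+1.
Proof.
rewrite -(card_ord_lt (ltn_ord (lo x))) -card_points /clow.
apply: eq_card => c; rewrite !inE block_reducible; case pc: (point c); [rewrite !andTb | by []].
rewrite block_ple -(eqP pc) ltnS; case: eqVneq => // ->; by rewrite leqnn.
Qed.

Lemma block_cup (x : T) : cup (@reducible (block G)) x = n - hi x.
Proof.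
rewrite -(card_ord_ge (ltnW (ltn_ord (hi x)))) -card_points /cup.
apply: eq_card => c; rewrite !inE block_reducible; case pc: (point c); [rewrite !andTb | by []].
rewrite block_ple; case: eqVneq => // e; rewrite -e in pc.
by rewrite -e (eqP pc) leqnn.
Qed.

Lemma block_fiber p q : p + q <= n ->
  [exists x : T, fiber p q x] =
  [exists i : 'I_n, exists j : 'I_n,
    [&& i < j, [set i; j] \in G, p == i.+1 & q == n - j]].
Proof.
move=> pq; apply/existsP/existsP => [[x]|[i /existsP[j /and4P[ij he /eqP-> /eqP->]]]].
  rewrite /fiber /= block_clow block_cup => /andP[/eqP e1 /eqP e2].
  have nx : ~~ point x.
    apply/negP => /eqP px; have := ltn_ord (lo x); rewrite px in e1 *; lia.
  have [lt inG _] := nonpoint nx.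
  by exists (lo x); apply/existsP; exists (hi x); rewrite lt inG e1 e2 !eqxx.
have nij : (i == j) = false by rewrite -val_eqE /=; lia.
have pz : block_cond G (i, j, false) by rewrite /block_cond /= nij ij he.
exists (Sub (i, j, false) pz); rewrite /fiber /= block_clow block_cup.
by rewrite /lo /hi /= !eqxx.
Qed.

(** Edges are read off from nonempty fibers, which isomorphisms preserve; this gives injectivity. *)
Lemma block_edge (i j : 'I_n) : i < j ->
  ([set i; j] \in G) = [exists x : T, fiber i.+1 (n - j) x].
Proof.
move=> ij; rewrite block_fiber; last by have := ltn_ord j; lia.
apply/idP/existsP => [he|[i' /existsP[j' /and4P[_ he /eqP[e1] /eqP e2]]]].
  by exists i; apply/existsP; exists j; rewrite ij he !eqxx.
have -> : i = i' by apply: val_inj.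
have -> // : j = j'.
by apply: val_inj => /=; have := ltn_ord j; have := ltn_ord j'; lia.
Qed.

(** The spine of points governs the removal of irreducible elements, the chain [chain0] the adjunct
    representation. *)
Lemma block_fundamental : 0 < n -> fundamental (block G).
Proof.
move=> n0; have hP := block_poset G; have hS := point_spine G n0.
have hA := chain0_adjunct_spine G n0.
split.
- split; first exact: spine_lattice hS.
  by move=> x y; rewrite !block_reducible; apply: point_total.
- apply: Or33 => z dz; have nz : ~~ point z.
    by apply: contraL dz; rewrite -block_reducible; apply: reducible_not_dirr.
  have [w [/andP[aw wb] wz _]] := nonpoint_between nz.
  exact: nullity_remove_isolated hS nz (nonpoint_isolated nz) aw wb wz.
- have [Q [rp [f [fbij fle hv hc [hu _]]]]] := adjunct_spine_rep hA (@chain0_distinct n G).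
  exists Q, rp; split=> //; last by exists f.
  have [tot mx] := adjunct_spine_maximal hA; have [g fg gf] := fbij.
  split=> [x y|z h].
    by rewrite -(gf x) -(gf y) !hc !fle; apply: tot.
  rewrite -(gf z) hc; apply: mx => x cx; rewrite -!fle gf.
  by apply: h; rewrite hc.
Qed.

End BlockD.

Lemma block_injective n l (G1 G2 : {set {set 'I_n}}) :
  G1 \in Dset n l -> G2 \in Dset n l -> iso (block G1) (block G2) -> G1 = G2.
Proof.
move=> h1 h2 h.
have key (i j : 'I_n) : i < j -> ([set i; j] \in G1) = ([set i; j] \in G2).
  by move=> ij; rewrite (block_edge h1 ij) (block_edge h2 ij); apply: fiber_exists_iso.
have [e1 _ _] := DsetP _ _ h1; have [e2 _ _] := DsetP _ _ h2.
apply/setP => e; apply/idP/idP => he.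
  by have [i [j [ij ee]]] := edge_ends (e1 e he); rewrite ee -key // -ee.
by have [i [j [ij ee]]] := edge_ends (e2 e he); rewrite ee key // -ee.
Qed.

(** * The graph of a fundamental block *)

Section Graph.
Variables (L : fposet) (hL : fundamental L) (n0 : 0 < nred L).
Local Notation n := (nred L).
Local Notation R := (@reducible L).

(** The inverse of [block] up to isomorphism, in the form dictated by [block_edge]. *)
Definition graph : {set {set 'I_n}} :=
  [set e | [exists i : 'I_n, exists j : 'I_n, [&& i < j, e == [set i; j]
             & [exists x : carrier L, fiber i.+1 (n - j) x]]]].

Lemma graph_edge (i j : 'I_n) : i < j ->
  ([set i; j] \in graph) = [exists x : carrier L, fiber i.+1 (n - j) x].
Proof.
move=> ij; rewrite inE; apply/existsP/idP.
  by move=> [i' /existsP[j' /and3P[ij' /eqP/(set2_ltn_inj ij ij')[-> ->] h]]].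
by move=> h; exists i; apply/existsP; exists j; rewrite ij eqxx h.
Qed.

Let hg : tight_spine L. Proof. exact: fundamental_tight_spine. Qed.
Let hS : spine R. Proof. by case: hg. Qed.

Lemma graph_irreducible (z : carrier L) : ~~ R z ->
  exists i j : 'I_n, [/\ i < j, [set i; j] \in graph, clow R z = i.+1 & cup R z = n - j].
Proof.
move=> nz; have s := clow_cup_out hS nz; rewrite -/(nred L) in s.
have l0 := clow_gt0 hS z; have u0 := cup_gt0 hS z.
have hi : (clow R z).-1 < n by lia.
have hj : n - cup R z < n by lia.
have ij : Ordinal hi < Ordinal hj by move=> /=; lia.
have e1 : clow R z = (Ordinal hi).+1 by rewrite /=; lia.
have e2 : cup R z = n - Ordinal hj by rewrite /=; lia.
exists (Ordinal hi), (Ordinal hj); split=> //.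
by rewrite graph_edge //; apply/existsP; exists z; rewrite /fiber /= -e1 -e2 !eqxx.
Qed.

Lemma graph_Dset : graph \in Dset n #|graph|.
Proof.
apply/DsetP; split=> // [e|v].
  rewrite inE => /existsP[i /existsP[j /and3P[ij /eqP-> _]]].
  by rewrite cards2 (_ : i != j) // -val_eqE /=; lia.
have [|r Rr lr] := @clow_surj _ _ hS v.+1; first by rewrite -/(nred L) ltn_ord.
have ur := clow_cup_in hS Rr; rewrite -/(nred L) in ur.
have [z nz hz] := reducible_attached hg Rr.
have [i [j [ij he e1 e2]]] := graph_irreducible nz.
exists [set i; j] => //; rewrite !inE; apply/orP; have := ltn_ord v; have := ltn_ord j.
by case: hz => e; [left | right]; apply/eqP; apply: val_inj => /=; lia.
Qed.

Lemma graph_iso : iso L (block graph).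
Proof.
have hD := graph_Dset; have en := block_nred hD.
apply: tight_spine_iso => //.
  by apply: fundamental_tight_spine; [exact: (block_fundamental hD n0) | rewrite en].
move=> p q pq; rewrite (block_fiber hD pq); apply/existsP/existsP.
  move=> [z /andP[/eqP zp /eqP zq]].
  have nz : ~~ R z.
    apply/negP => Rz; have := clow_cup_in hS Rz; rewrite -/(nred L); lia.
  have [i [j [ij he e1 e2]]] := graph_irreducible nz.
  by exists i; apply/existsP; exists j; rewrite ij he -zp -zq e1 e2 !eqxx.
move=> [i /existsP[j /and4P[ij he /eqP-> /eqP->]]].
by apply/existsP; rewrite -graph_edge.
Qed.

End Graph.

(** * Blocks without reducible elements, and the correspondence *)

(** If there were a second element, the top would be doubly irreducible, and the drop of nullity
    would give it an upper cover. *)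
Lemma irreducible_fundamental_card (L : fposet) :
  fundamental L -> nred L = 0 -> #|carrier L| = 1.
Proof.
case=> [[hL _] hB _] /card0_eq r0.
have nr x : ~~ @reducible L x by have := r0 x; rewrite !inE => ->.
have [_ c0 _ _] := hL.
case: (ltngtP #|carrier L| 1) => [|c1|//]; first by lia.
have [t ht] := lattice_bottom (is_lattice_dual hL).
have dt := irreducible_dirr hL (nr t).
case: hB => [//|/(_ t)|/(_ t dt) h]; first by rewrite dt.
have [[b /andP[tb _]] _ _] := nullity_drop hL c1 dt h.
by have [hP _ _ _] := hL; case: (pltF hP tb (ht b)).
Qed.

Lemma singleton_chain_fundamental :
  [/\ fundamental (chainP 1), nred (chainP 1) = 0 & nullity (chainP 1) = Posz 0].
Proof.
have nr (x : carrier (chainP 1)) : reducible x = false.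
  apply/negbTE/negP => /existsP[y /existsP[_ /and3P[ny _ _]]].
  by rewrite (ord1 y) (ord1 x) in ny.
have hA : @adjunct_spine (chainP 1) predT.
  split=> //; last by exists ord0.
  - by split=> [x|x y|y x z]; [exact: leqnn | rewrite (ord1 x) (ord1 y) | exact: leq_trans].
  - by move=> x y _ _; apply: leq_total.
split.
- split; first by split=> [|x y]; [exact: spine_lattice (adjunct_spineW hA) | rewrite nr].
    by apply: Or31; rewrite card_ord.
  exists (chainP 1), (RepChain 0); split=> //; first by split=> // x y _ _; apply: leq_total.
  by exists id; split=> //; exists id.
- by apply: eq_card0 => x; rewrite inE nr.
- by rewrite (adjunct_spine_nullity hA) eq_card0.
Qed.

(** The bijection with isomorphism classes is expressed by representatives: [g] is injective up to
    [iso] and meets every class. *)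
Theorem mainTheorem15 (n l : nat) :
  ((n + 1)./2 <= l <= 'C(n, 2))%N ->
  exists g : {set {set 'I_n}} -> fposet,
    [/\ (forall G, G \in Dset n l ->
           [/\ fundamental (g G), nred (g G) = n & nullity (g G) = Posz l]),
        (forall G1 G2, G1 \in Dset n l -> G2 \in Dset n l ->
           iso (g G1) (g G2) -> G1 = G2) &
        (forall L : fposet, fundamental L -> nred L = n -> nullity L = Posz l ->
           exists2 G, G \in Dset n l & iso L (g G))].
Proof.
case: (posnP n) => [-> /andP[_]|n0 _].
  (* The upper bound on [l] is 0 here, which leaves the empty graph and the one-element lattice. *)
  rewrite leqn0 => /eqP ->.
  have D0 G : (G \in Dset 0 0) -> G = set0 by move=> /DsetP[_ /cards0_eq].
  exists (fun _ => chainP 1); split.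
  - by move=> G _; apply: singleton_chain_fundamental.
  - by move=> G1 G2 /D0-> /D0->.
  - move=> L hL r0 _; exists set0.
      by apply/DsetP; split=> [e||[]//]; rewrite ?inE ?cards0.
    have c1 := irreducible_fundamental_card hL r0.
    have [[[hP _ _ _] _] _ _] := hL.
    have /card_gt0P[x0 _] : 0 < #|carrier L| by rewrite c1.
    have all x : x = x0 by apply: (card_le1_eq (A := predT)) => //; rewrite c1.
    exists (fun _ => ord0); split; last by move=> x y; rewrite (all x) (all y) (ple_refl hP).
    by exists (fun _ => x0) => [x|i]; rewrite ?(ord1 i) ?(all x).
exists (@block n); split.
- move=> G hG; have [h2 hl _] := DsetP _ _ hG; split.
  + exact: (block_fundamental hG n0).
  + exact: block_nred hG.
  + by rewrite block_nullity // hl.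
- by move=> G1 G2; apply: block_injective.
(* [graph L] lives on [nred L] vertices, so [n] is replaced by it; comparing nullities then gives
   the number of edges. *)
- move=> L hL en hl; subst n; have hi := graph_iso hL n0.
  have hD := graph_Dset hL n0; have [h2 _ _] := DsetP _ _ hD.
  have el : #|graph L| = l.
    have [[lat _] _ _] := hL.
    by have := nullity_iso lat hi; rewrite block_nullity // hl => -[].
  by exists (graph L) => //; rewrite -el.
Qed.
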